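(* Consider the linear model $\mathbf{y}=\alpha\mathbf{1}_n+\mathbf{X}\boldsymbol{\beta}+\sigma\boldsymbol{\epsilon}$ and Stein's loss $L_S(\delta,\sigma^2)=\delta/\sigma^2-\log(\delta/\sigma^2)-1$. Let $\phi:[0,1]\to(0,\infty)$ be monotone nondecreasing and let $\delta_\phi=\phi(R^2)\,\mathrm{RSS}/(n-p-1)$. Suppose that, when $\boldsymbol{\epsilon}\sim N_n(\mathbf{0}_n,\mathbf{I}_n)$, $\delta_\phi$ improves on the unbiased estimator $\delta_U=\mathrm{RSS}/(n-p-1)$, i.e. $E[L_S(\delta_\phi,\sigma^2)]\le E[L_S(\delta_U,\sigma^2)]$ for all $(\alpha,\boldsymbol{\beta},\sigma^2)$. Then $\delta_\phi$ also improves on $\delta_U$ (in the same sense, for all $(\alpha,\boldsymbol{\beta},\sigma^2)$) whenever the distribution of $\boldsymbol{\epsilon}$ is any scale mixture of normals, i.e. $\boldsymbol{\epsilon}=\tau\mathbf{Z}$ with $\mathbf{Z}\sim N_n(\mathbf{0}_n,\mathbf{I}_n)$ independent of a positive random scalar $\tau$ satisfying $E[\tau^2]=1$.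
   Context: Here $\mathbf{y}\in\mathbb{R}^n$ is observed, $\alpha\in\mathbb{R}$ is an unknown intercept, $\mathbf{1}_n$ is the $n$-vector of ones, $\mathbf{X}=(\mathbf{x}_1,\dots,\mathbf{x}_p)$ is a known $n\times p$ design matrix whose columns are centered ($\mathbf{x}_i'\mathbf{1}_n=0$) and linearly independent (rank $p$), $n>p+1$, $\boldsymbol{\beta}\in\mathbb{R}^p$ is unknown, and $\sigma>0$ is unknown. With $\bar y$ the mean of the entries of $\mathbf{y}$, $\mathrm{RSS}=\|(\mathbf{I}-\mathbf{X}(\mathbf{X}'\mathbf{X})^{-1}\mathbf{X}')(\mathbf{y}-\bar y\mathbf{1}_n)\|^2$ and $R^2=\|\mathbf{X}(\mathbf{X}'\mathbf{X})^{-1}\mathbf{X}'(\mathbf{y}-\bar y\mathbf{1}_n)\|^2/\|\mathbf{y}-\bar y\mathbf{1}_n\|^2$. Equivalently, a scale mixture of normals has density $f(\boldsymbol{\epsilon}'\boldsymbol{\epsilon})$ with $f(t)=\int_0^\infty(2\pi\tau^2)^{-n/2}\exp(-t/(2\tau^2))\,g(\tau^2)\,d\tau^2$ for a mixing density $g$ of $\tau^2$ with mean $1$. *)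

(* Defs.v *)
From HB Require Import structures.
From mathcomp Require Import all_boot all_order all_algebra.
From mathcomp Require Import all_classical all_reals all_analysis.
Set Implicit Arguments. Unset Strict Implicit. Unset Printing Implicit Defensive.
Import Order.TTheory GRing.Theory Num.Theory.
Local Open Scope classical_set_scope.
Local Open Scope ring_scope.

Section Model.
Variable R : realType.

Definition sqnorm (n : nat) (v : 'cV[R]_n) : R := \sum_(i < n) v i ord0 ^+ 2.

Definition ones (n : nat) : 'cV[R]_n := const_mx 1.

Definition mean (n : nat) (y : 'cV[R]_n) : R := (\sum_(i < n) y i ord0) / n%:R.

Definition hat (n p : nat) (X : 'M[R]_(n, p)) : 'M[R]_n :=
  X *m invmx (X^T *m X) *m X^T.

Definition centered_y (n : nat) (y : 'cV[R]_n) : 'cV[R]_n := y - mean y *: ones n.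

Definition RSS (n p : nat) (X : 'M[R]_(n, p)) (y : 'cV[R]_n) : R :=
  sqnorm ((1%:M - hat X) *m centered_y y).

Definition Rsq (n p : nat) (X : 'M[R]_(n, p)) (y : 'cV[R]_n) : R :=
  sqnorm (hat X *m centered_y y) / sqnorm (centered_y y).

Definition delta_phi (n p : nat) (X : 'M[R]_(n, p)) (phi : R -> R)
  (y : 'cV[R]_n) : R := phi (Rsq X y) * RSS X y / (n - p.+1)%:R.

Definition delta_U (n p : nat) (X : 'M[R]_(n, p)) (y : 'cV[R]_n) : R :=
  RSS X y / (n - p.+1)%:R.

Definition stein_loss (delta s2 : R) : R := delta / s2 - ln (delta / s2) - 1.

Definition obs (n p : nat) (X : 'M[R]_(n, p)) (alpha : R) (beta : 'cV[R]_p)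
  (sigma : R) (eps : 'cV[R]_n) : 'cV[R]_n :=
  alpha *: ones n + X *m beta + sigma *: eps.

Definition risk d (T : measurableType d) (P : probability T R) (n p : nat)
  (X : 'M[R]_(n, p)) (est : 'cV[R]_n -> R) (eps : T -> 'cV[R]_n)
  (alpha : R) (beta : 'cV[R]_p) (sigma : R) : \bar R :=
  'E_P[fun w => stein_loss (est (obs X alpha beta sigma (eps w))) (sigma ^+ 2)].

Definition improves_on_U d (T : measurableType d) (P : probability T R)
  (n p : nat) (X : 'M[R]_(n, p)) (phi : R -> R) (eps : T -> 'cV[R]_n) : Prop :=
  forall (alpha : R) (beta : 'cV[R]_p) (sigma : R), 0 < sigma ->
    (risk P X (delta_phi X phi) eps alpha beta sigma
       <= risk P X (delta_U X) eps alpha beta sigma)%E.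

Definition std_normal_vec d (T : measurableType d) (P : probability T R)
  (n : nat) (Z : T -> 'cV[R]_n) : Prop :=
  (forall i : 'I_n, measurable_fun setT (fun w => Z w i ord0)) /\
  (forall i : 'I_n, forall B : set R, measurable B ->
      P ((fun w => Z w i ord0) @^-1` B) = normal_prob 0 1 B) /\
  (forall B : 'I_n -> set R, (forall i, measurable (B i)) ->
      P (\bigcap_(i in setT) ((fun w => Z w i ord0) @^-1` B i))
      = (\prod_(i < n) P ((fun w => Z w i ord0) @^-1` B i))%E).

(* the real random variable tau is independent of the random vector Z
   (product rule on tau-events times measurable rectangles of Z, which form
   a pi-system generating sigma(Z)) *)
Definition indep_scalar_vec d (T : measurableType d) (P : probability T R)
  (n : nat) (tau : T -> R) (Z : T -> 'cV[R]_n) : Prop :=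
  forall (A : set R) (B : 'I_n -> set R), measurable A ->
    (forall i, measurable (B i)) ->
    P (tau @^-1` A `&` \bigcap_(i in setT) ((fun w => Z w i ord0) @^-1` B i))
    = (P (tau @^-1` A) * P (\bigcap_(i in setT) ((fun w => Z w i ord0) @^-1` B i)))%E.

End Model.

(* Main.v *)
(* Write the errors as [tau *: Z].  Given [tau], the model is normal with scale
   [sigma * tau], and with [V = RSS / (n - p - 1)] (computed from [Z]) the
   difference of the two losses is
     [(phi(R^2) - 1) V - ln phi(R^2) + (tau^2 - 1) (phi(R^2) - 1) V].
   The first two terms integrate to at most [0] by the normal hypothesis at scale
   [sigma * tau].  For the last one it suffices that [E (phi(R^2) V | tau)] is
   nonincreasing in [tau], since then [tau^2 - 1] and
   [E (phi(R^2) V | tau) - E (phi(R^2) V | tau = 1)] have opposite signs, while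
   [E tau^2 = 1].  This monotonicity is an Anderson-type inequality: [phi(R^2) V]
   is an even function of [Z] shifted by [(sigma tau)^-1 X beta] that increases
   with the absolute component along [X beta].  It is derived from the
   Cameron-Martin formula, which turns shifts into likelihood ratios. *)
Require Import Defs.
From HB Require Import structures.
From mathcomp Require Import all_boot all_order all_algebra.
From mathcomp Require Import all_classical all_reals all_analysis.
From mathcomp Require Import measurable_realfun ring lra.
Import Order.TTheory GRing.Theory Num.Theory.
Local Open Scope classical_set_scope.
Local Open Scope ring_scope.

Set Implicit Arguments.
Unset Strict Implicit.

(** * Least-squares projections *)

Section Projection.
Context {R : realType}.
Implicit Types (n p : nat).

Lemma sqnormE n (v : 'cV[R]_n) : (sqnorm v)%:M = v^T *m v.
Proof.
apply/matrixP => i j; rewrite !ord1 !mxE eqxx mulr1n.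
by apply: eq_bigr => k _; rewrite !mxE expr2.
Qed.

Lemma sqnorm_ge0 n (v : 'cV[R]_n) : 0 <= sqnorm v.
Proof. by apply: sumr_ge0 => i _; rewrite sqr_ge0. Qed.

Lemma sqnorm_eq0 n (v : 'cV[R]_n) : (sqnorm v == 0) = (v == 0).
Proof.
apply/idP/eqP => [|->]; last by rewrite /sqnorm big1// => i _; rewrite mxE expr0n.
rewrite psumr_eq0; last by move=> i _; rewrite sqr_ge0.
move=> /allP v0; apply/matrixP => i j; rewrite ord1 mxE.
by apply/eqP; rewrite -sqrf_eq0; apply: v0; rewrite mem_index_enum.
Qed.

Lemma sqnormZ n a (v : 'cV[R]_n) : sqnorm (a *: v) = a ^+ 2 * sqnorm v.
Proof. by rewrite /sqnorm mulr_sumr; apply: eq_bigr => i _; rewrite mxE exprMn. Qed.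

Lemma sqnormN n (v : 'cV[R]_n) : sqnorm (- v) = sqnorm v.
Proof. by rewrite -scaleN1r sqnormZ sqrrN expr1n mul1r. Qed.

Lemma sqnormD_orth n (u v : 'cV[R]_n) : u^T *m v = 0 ->
  sqnorm (u + v) = sqnorm u + sqnorm v.
Proof.
move=> uv; suff : (sqnorm (u + v))%:M = (sqnorm u + sqnorm v)%:M :> 'M[R]_1.
  by move=> /matrixP/(_ ord0 ord0); rewrite !mxE eqxx !mulr1n.
rewrite [RHS]raddfD/= !sqnormE [(u + v)^T]linearD/= mulmxDl !mulmxDr uv.
have -> : v^T *m u = 0 by rewrite -[LHS]trmxK trmx_mul trmxK uv trmx0.
by rewrite addr0 add0r.
Qed.

Definition inner n (u v : 'cV[R]_n) : R := \sum_(i < n) u i ord0 * v i ord0.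

Lemma innerE n (u v : 'cV[R]_n) : u^T *m v = (inner u v)%:M.
Proof.
apply/matrixP => i j; rewrite !ord1 !mxE eqxx mulr1n.
by apply: eq_bigr => k _; rewrite !mxE.
Qed.

Lemma inner_eq0 n (u v : 'cV[R]_n) : u^T *m v = 0 <-> inner u v = 0.
Proof.
rewrite innerE; split => [/matrixP/(_ ord0 ord0)|->]; last by rewrite raddf0.
by rewrite !mxE eqxx mulr1n.
Qed.

Lemma innerDr n (u v w : 'cV[R]_n) : inner u (v + w) = inner u v + inner u w.
Proof.
by rewrite /inner -big_split; apply: eq_bigr => i _; rewrite mxE mulrDr.
Qed.

Lemma innerZr n (u v : 'cV[R]_n) a : inner u (a *: v) = a * inner u v.
Proof. by rewrite /inner mulr_sumr; apply: eq_bigr => i _; rewrite mxE mulrCA. Qed.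

Lemma innerZl n (u v : 'cV[R]_n) a : inner (a *: u) v = a * inner u v.
Proof. by rewrite /inner mulr_sumr; apply: eq_bigr => i _; rewrite mxE mulrA. Qed.

Lemma innerC n (u v : 'cV[R]_n) : inner u v = inner v u.
Proof. by apply: eq_bigr => i _; rewrite mulrC. Qed.

Lemma inner_sqnorm n (u : 'cV[R]_n) : inner u u = sqnorm u.
Proof. by apply: eq_bigr => i _; rewrite expr2. Qed.

(** A vector [v] killed by the Gram matrix satisfies [|X v^T|^2 = 0], hence [X v^T = 0], and full
    column rank forces [v = 0]. *)
Lemma gram_unit {n p} {X : 'M[R]_(n, p)} : \rank X = p -> X^T *m X \in unitmx.
Proof.
move=> rX; rewrite -row_free_unit -kermx_eq0; apply/rowV0P => v /sub_kermxP vX.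
have Xv0 : X *m v^T = 0.
  apply/eqP; rewrite -sqnorm_eq0; apply/eqP.
  have : (sqnorm (X *m v^T))%:M = 0 :> 'M[R]_1.
    by rewrite sqnormE trmx_mul trmxK !mulmxA -(mulmxA v) vX mul0mx.
  by move=> /matrixP/(_ ord0 ord0); rewrite !mxE eqxx mulr1n.
have : v *m X^T = 0 by rewrite -[LHS]trmxK trmx_mul trmxK Xv0 trmx0.
by apply: contra_eq => v0; rewrite mulmx_free_eq0// /row_free mxrank_tr rX.
Qed.

Section Design.
Context {n p : nat} {X : 'M[R]_(n, p)}.
Hypothesis n0 : (0 < n)%N.
Hypothesis Xc : forall j : 'I_p, \sum_(i < n) X i j = 0.
Hypothesis rX : \rank X = p.

Let H := hat X.

Lemma hat_sym : H^T = H.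
Proof. by rewrite /H /hat !trmx_mul trmxK trmx_inv trmx_mul trmxK mulmxA. Qed.

Lemma hatX : H *m X = X.
Proof. by rewrite /H /hat -!mulmxA mulVmx ?mulmx1// gram_unit. Qed.

Lemma hat_idem : H *m H = H.
Proof. by rewrite {2}/H /hat !mulmxA hatX. Qed.

Lemma design_ones : X^T *m ones R n = 0.
Proof.
apply/matrixP => i j; rewrite !mxE -[RHS](Xc i).
by apply: eq_bigr => k _; rewrite !mxE mulr1.
Qed.

Lemma hat_ones : H *m ones R n = 0.
Proof. by rewrite /H /hat -mulmxA design_ones mulmx0. Qed.

Lemma hat_centered y : H *m centered_y y = H *m y.
Proof. by rewrite /centered_y mulmxBr -scalemxAr hat_ones scaler0 subr0. Qed.

Lemma mean_design b : mean (X *m b) = 0.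
Proof.
rewrite /mean; suff -> : \sum_(i < n) (X *m b) i ord0 = 0 by rewrite mul0r.
under eq_bigr do rewrite mxE.
by rewrite exchange_big/= big1// => j _; rewrite -mulr_suml Xc mul0r.
Qed.

Lemma mean_obs a b s z : mean (obs X a b s z) = a + s * mean z.
Proof.
have nn : n%:R != 0 :> R by rewrite pnatr_eq0 -lt0n.
rewrite -[RHS]addr0 -(mean_design b) /mean /obs -[a in RHS](mulfK nn) mulrA.
rewrite -!mulrDl; congr (_ / _).
transitivity (\sum_(i < n) (a + s * z i ord0 + (X *m b) i ord0)).
  by apply: eq_bigr => i _; rewrite !mxE; ring.
by rewrite !big_split/= sumr_const card_ord mulr_natr mulr_sumr.
Qed.

Lemma centered_obs a b s z :
  centered_y (obs X a b s z) = X *m b + s *: centered_y z.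
Proof.
rewrite /centered_y mean_obs /obs.
by apply/matrixP => i j; rewrite !mxE; ring.
Qed.

Lemma resid_obs a b s z :
  (1%:M - H) *m centered_y (obs X a b s z) = s *: ((1%:M - H) *m centered_y z).
Proof.
rewrite centered_obs mulmxDr -scalemxAr mulmxA.
by rewrite [(_ - H) *m X]mulmxBl mul1mx hatX subrr mul0mx add0r.
Qed.

Lemma RSS_obs a b s z : RSS X (obs X a b s z) = s ^+ 2 * RSS X z.
Proof. by rewrite /RSS resid_obs sqnormZ. Qed.

Lemma hat_obs a b s z : H *m obs X a b s z = X *m b + s *: (H *m z).
Proof.
by rewrite -hat_centered centered_obs mulmxDr -scalemxAr mulmxA hatX hat_centered.
Qed.

(** Pythagoras splits the centered vector into fitted part and residual. In this form a shift along
    the column space acts on one term only, because it leaves [RSS] unchanged. *)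
Lemma RsqE y : Rsq X y = sqnorm (H *m y) / (sqnorm (H *m y) + RSS X y).
Proof.
rewrite /Rsq hat_centered /RSS -sqnormD_orth -/H.
  by congr (_ / sqnorm _); rewrite mulmxBl mul1mx hat_centered subrKC.
rewrite trmx_mul hat_sym -mulmxA (mulmxA H) [H *m (_ - _)]mulmxBr mulmx1 hat_idem subrr.
by rewrite mul0mx mulmx0.
Qed.

Lemma RSS_ge0 y : 0 <= RSS X y. Proof. exact: sqnorm_ge0. Qed.

Lemma Rsq_itv y : 0 <= Rsq X y <= 1.
Proof.
rewrite RsqE; have := sqnorm_ge0 (H *m y); have := RSS_ge0 y.
move: (RSS _ _) (sqnorm _) => v a v0 a0.
rewrite divr_ge0 ?addr_ge0//=.
have [/eqP|av] := eqVneq (a + v) 0; first by move=> /eqP ->; rewrite invr0 mulr0 ler01.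
by rewrite ler_pdivrMr ?mul1r ?lerDl// lt0r av addr_ge0.
Qed.

Lemma RSS_shift z b : RSS X (z + X *m b) = RSS X z.
Proof.
have -> : z + X *m b = obs X 0 b 1 z by rewrite /obs scale0r add0r scale1r addrC.
by rewrite RSS_obs expr1n mul1r.
Qed.

(** The coefficient is invariant under scaling and blind to the intercept, so it sees the parameters
    only through the noncentrality vector [s^-1 X b]. *)
Lemma Rsq_obs a b s z : s != 0 ->
  Rsq X (obs X a b s z) = Rsq X (z + s^-1 *: (X *m b)).
Proof.
move=> s0; rewrite !RsqE hat_obs RSS_obs [_ *: (X *m b)]scalemxAr RSS_shift mulmxDr mulmxA hatX.
have -> : X *m b + s *: (H *m z) = s *: (H *m z + X *m (s^-1 *: b)).
  by rewrite scalerDr -scalemxAr scalerA mulfV// scale1r addrC.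
rewrite sqnormZ -mulrDr invfM mulrACA mulfV ?mul1r// expf_neq0//.
Qed.

Lemma RSS_N z : RSS X (- z) = RSS X z.
Proof.
have -> : - z = obs X 0 0 (-1) z by rewrite /obs scale0r add0r mulmx0 add0r scaleN1r.
by rewrite RSS_obs sqrrN expr1n mul1r.
Qed.

Lemma Rsq_N z : Rsq X (- z) = Rsq X z.
Proof. by rewrite !RsqE RSS_N mulmxN sqnormN. Qed.

Lemma sqnorm_hat_orth x b r : inner (X *m b) x = 0 ->
  sqnorm (H *m (x + r *: (X *m b)))
  = sqnorm (H *m x) + r ^+ 2 * sqnorm (X *m b).
Proof.
move=> bx; rewrite mulmxDr -scalemxAr mulmxA hatX sqnormD_orth ?sqnormZ//.
rewrite -scalemxAr trmx_mul hat_sym -mulmxA (mulmxA H) hatX.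
by have /inner_eq0 -> : inner x (X *m b) = 0 by [rewrite innerC]; rewrite scaler0.
Qed.

Lemma RSS_line x b r : RSS X (x + r *: (X *m b)) = RSS X x.
Proof. by rewrite scalemxAr RSS_shift. Qed.

(** For [x] orthogonal to [X b], the fitted part is [a + r^2 |X b|^2] with [RSS = v] constant along
    the line, and [u / (u + v)] increases with [u]. *)
Lemma le_Rsq_line x b (r1 r2 : R) : inner (X *m b) x = 0 -> `|r1| <= `|r2| ->
  Rsq X (x + r1 *: (X *m b)) <= Rsq X (x + r2 *: (X *m b)).
Proof.
move=> bx r12; rewrite !RsqE !sqnorm_hat_orth// !RSS_line.
have : r1 ^+ 2 * sqnorm (X *m b) <= r2 ^+ 2 * sqnorm (X *m b).
  rewrite ler_wpM2r ?sqnorm_ge0// -(real_normK (num_real r1)).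
  by rewrite -(real_normK (num_real r2)) ler_sqr ?nnegrE.
have := mulr_ge0 (sqr_ge0 r1) (sqnorm_ge0 (X *m b)).
have := sqnorm_ge0 (H *m x); have := RSS_ge0 x.
move: (RSS _ _) (sqnorm (H *m x)) (_ * _) (_ * _) => v a d c v0 a0 c0 cd.
(* A zero denominator makes the left-hand quotient [0] by the convention for inverses. *)
have [ac0|ac0] := eqVneq (a + c + v) 0.
  rewrite ac0 invr0 mulr0. rewrite divr_ge0//; lra.
have acp : 0 < a + c + v by rewrite lt0r ac0; lra.
rewrite ler_pdivrMr// mulrAC ler_pdivlMr; last lra.
have : v * c <= v * d by rewrite ler_wpM2l.
by move=> ?; rewrite -subr_ge0 [X in 0 <= X](_ : _ = v * d - v * c) ?subr_ge0//; ring.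
Qed.

End Design.
End Projection.

(** * Shifts of Gaussian measures *)

Section StandardNormal.
Context {R : realType}.
Local Open Scope ereal_scope.
Local Notation leb := (@lebesgue_measure R).
Local Notation N01 := (@normal_prob R 0 1).
Local Notation pdf := (@normal_pdf R 0 1).

(** The Radon-Nikodym derivative of the normal law and the explicit density have equal integrals
    over every measurable set, so they agree almost everywhere. *)
Lemma ge0_integral_normal_prob (f : measurableTypeR R -> \bar R) :
  measurable_fun [set: measurableTypeR R] f -> (forall x, 0 <= f x) ->
  \int[N01]_x f x = \int[leb]_x (f x * (pdf x)%:E).
Proof.
move=> mf f0; have dom := @normal_prob_dominates R 0 1.
rewrite -(@Radon_Nikodym_SigmaFinite.change_of_variables _ _ _ _ leb _ f)//.
have mpdf : measurable_fun [set: measurableTypeR R] (EFin \o pdf).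
  by apply/measurable_EFinP; exact: measurable_normal_pdf.
apply: ae_eq_integral => //.
- apply: emeasurable_funM => //.
  exact: measurable_int (Radon_Nikodym_SigmaFinite.f_integrable _).
- exact: emeasurable_funM.
apply: ae_eqe_mul2l; apply: integral_ae_eq => //.
- exact: Radon_Nikodym_SigmaFinite.f_integrable.
- by move=> A _ mA; rewrite -Radon_Nikodym_SigmaFinite.f_integral.
Qed.

Lemma lebesgue_measure_shift (c : R) (A : set R) : measurable A ->
  leb ((fun x => (x + c)%R) @^-1` A) = leb A.
Proof.
move=> mA.
have mc : measurable_fun [set: measurableTypeR R]
    (fun x : measurableTypeR R => (x + c)%R : measurableTypeR R).
  exact: measurable_funD.
suff : leb A = pushforward leb (fun x : measurableTypeR R => (x + c)%R : measurableTypeR R) A by [].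
apply: lebesgue_measure_unique => //= _ [[a b]] _ <-; rewrite /pushforward.
have -> : (fun x : R => (x + c)%R) @^-1` `]a, b]%classic = `](a - c)%R, (b - c)%R]%classic.
  by apply/seteqP; split => x /=; rewrite !in_itv/= ltrBlDr lerBrDr.
rewrite !lebesgue_measure_itv/= !lte_fin ltrD2r; case: ifP => // _.
by rewrite -!EFinB; congr EFin; lra.
Qed.

Lemma ge0_integral_lebesgue_shift (c : R) (f : R -> \bar R) :
  measurable_fun [set: measurableTypeR R] f -> (forall x, 0 <= f x) ->
  \int[leb]_x f (x + c)%R = \int[leb]_x f x.
Proof.
move=> mf f0.
have mc : measurable_fun [set: measurableTypeR R]
    (fun x : measurableTypeR R => (x + c)%R : measurableTypeR R).
  exact: measurable_funD.
transitivity (\int[pushforward leb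
    (fun x : measurableTypeR R => (x + c)%R : measurableTypeR R)]_x f x).
  by rewrite ge0_integral_pushforward.
apply: eq_measure_integral => A mA _; exact: lebesgue_measure_shift.
Qed.

Lemma normal_pdf_shift (c x : R) :
  pdf (x - c)%R = (expR (c * x - c ^+ 2 / 2) * pdf x)%R.
Proof.
rewrite !normal_pdfE ?oner_neq0// /normal_fun mulrCA -expRD.
by congr (_ * expR _)%R; field.
Qed.

(** One-dimensional Cameron-Martin formula: translation invariance of Lebesgue measure moves the
    shift to the density, where it appears as a likelihood ratio. *)
Lemma ge0_integral_normal_shift (c : R) (f : R -> \bar R) :
  measurable_fun [set: measurableTypeR R] f -> (forall x, 0 <= f x) ->
  \int[N01]_x f (x + c)%R = \int[N01]_x (f x * (expR (c * x - c ^+ 2 / 2))%:E).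
Proof.
move=> mf f0.
have mc : measurable_fun [set: R] (fun x : R => (x + c)%R) by exact: measurable_funD.
have me : measurable_fun [set: R] (fun x : R => expR (c * x - c ^+ 2 / 2)).
  by apply: measurableT_comp => //; apply: measurable_funB => //; exact: measurable_funM.
rewrite !ge0_integral_normal_prob//; last 3 first.
- by apply: emeasurable_funM => //; exact/measurable_EFinP.
- by move=> x; rewrite mule_ge0// lee_fin expR_ge0.
- exact: measurableT_comp.
rewrite -[LHS](@ge0_integral_lebesgue_shift (- c)%R); last 2 first.
- apply: emeasurable_funM; first exact: measurableT_comp.
  by apply/measurable_EFinP; exact: measurable_normal_pdf.
- by move=> x; rewrite mule_ge0// lee_fin normal_pdf_ge0.
apply: eq_integral => x _.
by rewrite subrK normal_pdf_shift EFinM muleA.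
Qed.

Lemma normal_prob_opp (A : set R) : measurable A -> N01 (-%R @^-1` A) = N01 A.
Proof.
move=> mA.
have mN : measurable_fun [set: measurableTypeR R] (-%R : measurableTypeR R -> measurableTypeR R).
  exact: oppr_measurable.
transitivity (\int[pushforward leb (-%R : _ -> measurableTypeR R)]_(x in A) (pdf x)%:E); last first.
  by apply: eq_measure_integral => B mB _; exact: lebesgue_measureN.
rewrite (ge0_integral_pushforward mN); [|exact: mA| |].
- apply: eq_integral => x _ /=; rewrite !normal_pdfE ?oner_neq0// /normal_fun.
  by rewrite !subr0 sqrrN.
- apply: measurable_funTS; apply/measurable_EFinP; exact: measurable_normal_pdf.
- by move=> x _; rewrite lee_fin normal_pdf_ge0.
Qed.

End StandardNormal.

(** * Gaussian vectors and the Cameron-Martin formula *)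

Section VectorSpace.
Context {R : realType} (n : nat).
Local Open Scope ereal_scope.

Definition rect (B : 'I_n -> set R) : set 'cV[R]_n :=
  [set z | forall i, B i (z i ord0)].

(** These sets generate the sigma-algebra used on column vectors. Normality of [Z] and independence
    of [tau] are stated as product rules on exactly these sets. *)
Definition rects : set (set 'cV[R]_n) :=
  [set rect B | B in [set B | forall i, measurable (B i)]].

End VectorSpace.

Section GaussianVector.
Import numFieldNormedType.Exports.
Context {R : realType} {n : nat}.
Local Open Scope ereal_scope.
Local Notation W := (g_sigma_algebraType (@rects R n)).
Local Notation N01 := (@normal_prob R 0 1).

Lemma measurable_rect (B : 'I_n -> set R) :
  (forall i, measurable (B i)) -> measurable (rect B : set W).
Proof. by move=> mB; apply: sub_sigma_algebra; exists B. Qed.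

Lemma rects_setI : setI_closed (@rects R n).
Proof.
move=> _ _ [A mA <-] [B mB <-]; exists (fun i => A i `&` B i).
  by move=> i; exact: measurableI.
apply/seteqP; split => z /=.
  by move=> AB; split => i; have [] := AB i.
by move=> [zA zB] i; split; [exact: zA|exact: zB].
Qed.

Lemma rect_setT : rect (fun=> setT) = setT :> set 'cV[R]_n.
Proof. by apply/seteqP; split. Qed.

Lemma measurable_coord i : measurable_fun [set: W] (fun z : W => (z : 'cV[R]_n) i ord0).
Proof.
move=> _ B mB; rewrite setTI.
have -> : (fun z : W => (z : 'cV[R]_n) i ord0) @^-1` B
  = rect (fun j => if j == i then B else setT).
  apply/seteqP; split => z /=; last by move=> /(_ i); rewrite eqxx.
  by move=> Bz j; case: eqP => // ->.
by apply: measurable_rect => j; case: ifP.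
Qed.

Lemma measurable_cVP d (T : measurableType d) (f : T -> W) :
  (forall i, measurable_fun [set: T] (fun x => (f x : 'cV[R]_n) i ord0)) ->
  measurable_fun [set: T] f.
Proof.
move=> mf; apply: (@measurability _ _ T W setT f (@rects R n)) => //.
move=> _ [_ [B mB <-] <-]; rewrite setTI.
have -> : f @^-1` rect B
  = \bigcap_(i in [set: 'I_n]) ((fun x => (f x : 'cV[R]_n) i ord0) @^-1` B i).
  by apply/seteqP; split => x /= fB i; [move=> _|]; apply: fB.
apply: fin_bigcap_measurable => [|i _]; first exact: finite_finset.
by rewrite -[X in measurable X]setTI; exact: mf.
Qed.

(** The rectangles form a pi-system that contains the whole space, so the uniqueness theorem for
    finite measures applies with a constant exhausting sequence. *)
Lemma measure_cV_unique (m1 m2 : {measure set W -> \bar R}) :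
  (forall B, (forall i, measurable (B i)) -> m1 (rect B) = m2 (rect B)) ->
  m1 setT < +oo ->
  forall A, measurable A -> m1 A = m2 A.
Proof.
move=> m12 m1oo A mA.
apply: (@measure_unique _ R W (@rects R n) (fun=> setT) erefl _ _ _ m1 m2 _ _ A mA) => //.
- exact: rects_setI.
- by move=> _; exists (fun=> setT) => //; exact: rect_setT.
- by rewrite bigcup_const.
- by move=> _ [B mB <-]; exact: m12.
Qed.

Definition std_normal_law (mu : probability W R) := forall B : 'I_n -> set R,
  (forall i, measurable (B i)) -> mu (rect B) = \prod_(i < n) N01 (B i).

Variable mu : probability W R.
Hypothesis muN : std_normal_law mu.

Definition set_coord (i : 'I_n) (x : R) (z : 'cV[R]_n) : 'cV[R]_n :=
  \col_j (if j == i then x else z j ord0).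

Lemma measurable_set_coord i :
  measurable_fun [set: R * W] (fun xz => set_coord i xz.1 xz.2 : W).
Proof.
apply: measurable_cVP => j; rewrite /set_coord.
under eq_fun do rewrite mxE.
case: eqP => _; first exact: measurable_fst.
by apply: (measurableT_comp (measurable_coord j)); exact: measurable_snd.
Qed.

(** The preimage of a rectangle under resampling is [B i] times a rectangle with side [i] free, and
    has the same product mass. Uniqueness of measures and Tonelli give the rest. *)
Lemma ge0_integral_resample i (F : W -> \bar R) :
  measurable_fun [set: W] F -> (forall z, 0 <= F z) ->
  \int[mu]_z F z = \int[mu]_z \int[N01]_x F (set_coord i x z).
Proof.
move=> mF F0; have mS := measurable_set_coord i.
rewrite -(@fubini_tonelli2 _ _ _ _ _ N01 mu (fun xz => F (set_coord i xz.1 xz.2)))//.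
  transitivity (\int[pushforward (N01 \x mu) (fun xz => set_coord i xz.1 xz.2 : W)]_z F z).
    apply: eq_measure_integral => A mA _.
    apply: measure_cV_unique => //=; last first.
      by rewrite (le_lt_trans (probability_le1 _ _))// ltry.
    move=> B mB; rewrite /pushforward/=.
    have -> : (fun xz : R * W => set_coord i xz.1 xz.2 : W) @^-1` rect B =
      B i `*` rect (fun j => if j == i then setT else B j).
      apply/seteqP; split => [[x z]|[x z] []] /=.
        move=> h; split; first by have := h i; rewrite mxE eqxx.
        by move=> j; have := h j; rewrite mxE; case: eqP.
      move=> xB zB j; rewrite mxE; case: eqP => [->//|/eqP ji].
      by have := zB j; rewrite (negbTE ji).
    rewrite product_measure1E; [|exact: mB|]; last first.
      by apply: measurable_rect => j; case: ifP.
    etransitivity; first exact: muN mB.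
    rewrite (bigD1 i)//=; congr (_ * _); apply/esym.
    etransitivity; first by apply: muN => j; case: ifP.
    rewrite (bigD1 i)//= eqxx probability_setT mul1e.
    by apply: eq_bigr => j /negbTE ->.
  by rewrite ge0_integral_pushforward.
exact: (measurableT_comp mF mS).
Qed.

(* Resampling the [i]-th coordinate leaves the law of [z] unchanged and reduces
   the formula to its one-dimensional version. *)
Lemma ge0_integral_shift_coord i (c : R) (F : W -> \bar R) :
  measurable_fun [set: W] F -> (forall z, 0 <= F z) ->
  \int[mu]_z F ((z : 'cV[R]_n) + c *: delta_mx i ord0)%R =
  \int[mu]_z (F z * (expR (c * (z : 'cV[R]_n) i ord0 - c ^+ 2 / 2))%:E).
Proof.
move=> mF F0.
have mS : measurable_fun [set: W] (fun z : W => ((z : 'cV[R]_n) + c *: delta_mx i ord0)%R : W).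
  apply: measurable_cVP => j; under eq_fun do rewrite !mxE.
  by apply: measurable_funD => //; exact: measurable_coord.
rewrite (ge0_integral_resample i)//; last exact: (measurableT_comp mF mS).
rewrite [RHS](ge0_integral_resample i); last 2 first.
- apply: emeasurable_funM => //; apply/measurable_EFinP.
  apply: measurableT_comp => //; apply: measurable_funB => //.
  by apply: measurable_funM => //; exact: measurable_coord.
- by move=> z; rewrite mule_ge0// lee_fin expR_ge0.
apply: eq_integral => z _.
have mz : measurable_fun [set: R] (fun x => F (set_coord i x z)).
  apply: (measurableT_comp mF).
  exact: (measurableT_comp (measurable_set_coord i) (pair2_measurable z)).
rewrite [RHS](_ : _ = \int[N01]_x
  (F (set_coord i x z) * (expR (c * x - c ^+ 2 / 2))%:E)); last first.
  by apply: eq_integral => x _; rewrite mxE eqxx.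
rewrite -ge0_integral_normal_shift//.
apply: eq_integral => x _; congr F; apply/matrixP => j k.
rewrite !mxE (ord1 k) eqxx andbT; case: eqP => _; first by rewrite mulr1.
by rewrite mulr0 addr0.
Qed.

(** Cameron-Martin formula, obtained by shifting one coordinate after another and multiplying the
    likelihood ratios. *)
Lemma ge0_integral_shift (a : 'cV[R]_n) (F : W -> \bar R) :
  measurable_fun [set: W] F -> (forall z, 0 <= F z) ->
  \int[mu]_z F ((z : 'cV[R]_n) + a)%R =
  \int[mu]_z (F z * (expR (inner a z - sqnorm a / 2))%:E).
Proof.
pose tr (s : seq 'I_n) : 'cV[R]_n := (\sum_(i <- s) a i ord0 *: delta_mx i ord0)%R.
pose dn (s : seq 'I_n) (z : 'cV[R]_n) : R :=
  (\sum_(i <- s) (a i ord0 * z i ord0 - a i ord0 ^+ 2 / 2))%R.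
have mtr s : measurable_fun [set: W] (fun z : W => ((z : 'cV[R]_n) + tr s)%R : W).
  apply: measurable_cVP => j; under eq_fun do rewrite !mxE.
  by apply: measurable_funD => //; exact: measurable_coord.
(* Induction on a list of distinct coordinates: [tr s] is the partial shift and [dn s] its
   log-likelihood ratio. [F] is generalized because the ratios already produced are absorbed into
   it. *)
suff main s : uniq s -> forall F : W -> \bar R,
    measurable_fun [set: W] F -> (forall z, 0 <= F z) ->
    \int[mu]_z F ((z : 'cV[R]_n) + tr s)%R = \int[mu]_z (F z * (expR (dn s z))%:E).
  move=> mF F0; have := main (enum 'I_n) (enum_uniq _) F mF F0.
  have -> : tr (enum 'I_n) = a.
    apply/matrixP => i j; rewrite /tr big_enum/= summxE (bigD1 i)//= big1 => [|k ki].
      by rewrite !mxE (ord1 j) !eqxx mulr1 addr0.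
    by rewrite !mxE eq_sym (negbTE ki) mulr0.
  move=> ->; apply: eq_integral => z _; rewrite /dn big_enum/=.
  by rewrite sumrB mulr_suml.
clear F; elim: s => [_ F mF F0|i s IH /=/andP[ni us] F mF F0].
  rewrite /tr /dn !big_nil; apply: eq_integral => z _.
  by rewrite addr0 big_nil expR0 mule1.
rewrite /tr big_cons -/(tr s).
under eq_integral do rewrite addrA.
rewrite (@ge0_integral_shift_coord i (a i ord0) (fun z : W => F ((z : 'cV[R]_n) + tr s)%R));
  [|exact: (measurableT_comp mF (mtr s))|by move=> z; exact: F0].
pose F' (z : W) := F z * (expR (a i ord0 * (z : 'cV[R]_n) i ord0 - a i ord0 ^+ 2 / 2))%:E.
have mF' : measurable_fun [set: W] F'.
  apply: emeasurable_funM => //; apply/measurable_EFinP.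
  apply: measurableT_comp => //; apply: measurable_funB => //.
  by apply: measurable_funM => //; exact: measurable_coord.
(* As [i] is not in [s], the remaining shift fixes coordinate [i], so the ratio for [i] can be moved
   inside the shifted integrand. *)
have trs0 : tr s i ord0 = 0%R.
  rewrite /tr summxE big1_seq// => j /= js.
  by rewrite !mxE (_ : (i == j) = false) ?mulr0//; apply: contraNF ni => /eqP ->.
transitivity (\int[mu]_z F' ((z : 'cV[R]_n) + tr s)%R).
  by apply: eq_integral => z _; rewrite /F' mxE trs0 addr0.
rewrite (IH us _ mF'); last by move=> z; rewrite mule_ge0// lee_fin expR_ge0.
apply: eq_integral => z _.
by rewrite /F' /dn big_cons -muleA -EFinM -expRD.
Qed.

Lemma ge0_integral_opp (F : W -> \bar R) :
  measurable_fun [set: W] F -> (forall z, 0 <= F z) ->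
  \int[mu]_z F (- (z : 'cV[R]_n))%R = \int[mu]_z F z.
Proof.
move=> mF F0.
have mN : measurable_fun [set: W] (fun z : W => (- (z : 'cV[R]_n))%R : W).
  apply: measurable_cVP => j; under eq_fun do rewrite !mxE.
  by apply: measurableT_comp => //; exact: measurable_coord.
transitivity (\int[pushforward mu (fun z : W => (- (z : 'cV[R]_n))%R : W)]_z F z).
  by rewrite ge0_integral_pushforward.
apply: eq_measure_integral => A mA _.
apply: measure_cV_unique => //=; last first.
  by rewrite /pushforward/= preimage_setT probability_setT ltry.
move=> B mB; rewrite /pushforward/=.
have -> : (fun z : W => (- (z : 'cV[R]_n))%R : W) @^-1` rect B =
    rect (fun i => -%R @^-1` B i).
  by apply/seteqP; split => z /= h i; have := h i; rewrite mxE.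
have mNB i : measurable (-%R @^-1` B i).
  by rewrite -[X in measurable X]setTI; exact: oppr_measurable.
etransitivity; first exact: (muN mNB).
etransitivity; last exact: (esym (muN mB)).
by apply: eq_bigr => i _; exact: normal_prob_opp.
Qed.

End GaussianVector.

(** * Monotonicity in the noncentrality *)

Section HyperbolicKernel.
Import numFieldNormedType.Exports.
Context {R : realType}.
Implicit Types x y s t l N : R.

Definition cosh x : R := (expR x + expR (- x)) / 2.

Lemma coshN x : cosh (- x) = cosh x.
Proof. by rewrite /cosh opprK addrC. Qed.

Lemma cosh_abs x : cosh `|x| = cosh x.
Proof. by have [_|_] := ger0P x; rewrite ?coshN. Qed.

Lemma cosh_gt0 x : 0 < cosh x.
Proof. by rewrite divr_gt0// addr_gt0// expR_gt0. Qed.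

Lemma le_cosh x y : `|x| <= `|y| -> cosh x <= cosh y.
Proof.
rewrite -(cosh_abs x) -(cosh_abs y); have := normr_ge0 x.
move: `|x| `|y| => {}x {}y x0 xy; rewrite /cosh ler_pM2r ?invr_gt0//.
rewrite !expRN; have : 1 <= expR x by rewrite -expR0 ler_expR.
have : expR x <= expR y by rewrite ler_expR.
move: (expR x) (expR y) => a b ab a1.
have a0 : 0 < a by lra.
have b0 : 0 < b by lra.
rewrite -subr_ge0 [X in 0 <= X](_ : _ = (b - a) * (1 - (a * b)^-1)).
  have ab1 : 1 <= a * b by nra.
  by rewrite mulr_ge0 ?subr_ge0// invf_le1// mulr_gt0.
by field; rewrite !gt_eqF.
Qed.

Lemma cosh_mul x y : cosh x * cosh y = (cosh (x + y) + cosh (x - y)) / 2.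
Proof. by rewrite /cosh !opprD !opprK !expRD; field. Qed.

(** Total positivity of order 2. After the product-to-sum formula the arguments compare termwise,
    the gaps being [(l2 - l1) (t - s)], [(l2 + l1) (t - s)] and [(l2 - l1) (t + s)]. *)
Lemma cosh_tp2 l1 l2 s t : 0 <= l1 -> l1 <= l2 -> 0 <= s -> s <= t ->
  cosh (l2 * s) * cosh (l1 * t) <= cosh (l2 * t) * cosh (l1 * s).
Proof.
move=> l10 l12 s0 st; rewrite !cosh_mul ler_pM2r ?invr_gt0// lerD//.
  apply: le_cosh; rewrite !ger0_norm; first nra.
    by rewrite addr_ge0// mulr_ge0//; lra.
  by rewrite addr_ge0// mulr_ge0//; lra.
apply: le_cosh; rewrite [leRHS]ger0_norm; last nra.
by rewrite ler_norml; apply/andP; split; nra.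
Qed.

(* The average of the Gaussian likelihood ratios for shifts by [l] and [- l]. *)
Definition shift_kernel N l s : R := expR (- (l ^+ 2 * N / 2)) * cosh (l * s).

Lemma shift_kernel_ge0 N l s : 0 <= shift_kernel N l s.
Proof. by rewrite mulr_ge0 ?expR_ge0// ltW// cosh_gt0. Qed.

Lemma shift_kernel_abs N l s : 0 <= l ->
  shift_kernel N l `|s| = shift_kernel N l s.
Proof.
by move=> l0; rewrite /shift_kernel -(cosh_abs (l * s)) normrM (ger0_norm l0).
Qed.

Lemma continuous_cosh : continuous cosh.
Proof.
move=> x; apply: cvgMl; apply: cvgD; first exact: continuous_expR.
apply: (@continuous_comp _ _ _ -%R expR); first exact: opp_continuous.
exact: continuous_expR.
Qed.

(** By [cosh_tp2] the ratio of the two kernels is nondecreasing in [|s|], so they change order at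
    any point where they are equal. Such a point comes from the intermediate value theorem. *)
Lemma shift_kernel_crossing N l1 l2 : 0 <= N -> 0 <= l1 -> l1 <= l2 ->
  exists s0, forall s,
    (`|s| <= `|s0| -> shift_kernel N l2 s <= shift_kernel N l1 s) /\
    (`|s0| <= `|s| -> shift_kernel N l1 s <= shift_kernel N l2 s).
Proof.
move=> N0 l10 l12.
have [<-|l1l2] := eqVneq l1 l2; first by exists 0.
have {l1l2} l12' : l1 < l2 by rewrite lt_neqAle l1l2.
pose D s := shift_kernel N l2 s - shift_kernel N l1 s.
set E1 := expR (- (l1 ^+ 2 * N / 2)); set E2 := expR (- (l2 ^+ 2 * N / 2)).
have E20 : 0 < E2 by exact: expR_gt0.
have E10 : 0 < E1 by exact: expR_gt0.
(* Chosen so that [(l2 - l1) M = 2 / E2]. Then [expR ((l2 - l1) M) >= 2 / E2], which gives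
   [E2 expR (l2 M) / 2 >= expR (l1 M)]. *)
pose M := 2 / (E2 * (l2 - l1)).
have M0 : 0 <= M by rewrite divr_ge0// mulr_ge0 ?subr_ge0// ltW.
have D0 : D 0 <= 0.
  rewrite subr_le0 /shift_kernel !mulr0 ler_pM2r ?cosh_gt0// ler_expR lerN2.
  by rewrite ler_pM2r ?invr_gt0// ler_wpM2r// ler_sqr ?nnegrE//; lra.
have DM : 0 <= D M.
  rewrite subr_ge0 /shift_kernel -/E1 -/E2.
  have h1 : E1 * cosh (l1 * M) <= expR (l1 * M).
    have : E1 <= 1.
      by rewrite -expR0 ler_expR oppr_le0 divr_ge0// mulr_ge0// sqr_ge0.
    have : cosh (l1 * M) <= expR (l1 * M).
      rewrite /cosh; have : expR (- (l1 * M)) <= expR (l1 * M).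
        by rewrite ler_expR; have : 0 <= l1 * M; [exact: mulr_ge0|lra].
      lra.
    have := cosh_gt0 (l1 * M); nra.
  have h2 : E2 * expR (l2 * M) / 2 <= E2 * cosh (l2 * M).
    rewrite -mulrA ler_pM2l// ler_pM2r ?invr_gt0// lerDl expR_ge0//.
  apply: (le_trans h1); apply: le_trans h2.
  have -> : l2 * M = (l2 - l1) * M + l1 * M by ring.
  rewrite expRD.
  have : 2 / E2 <= expR ((l2 - l1) * M).
    apply: le_trans (expR_ge1Dx _).
    have -> : (l2 - l1) * M = 2 / E2.
      by rewrite /M; field; rewrite !gt_eqF// subr_gt0.
    lra.
  rewrite ler_pdivrMr// => h3.
  have := expR_gt0 (l1 * M); nra.
have [s0 /andP[s00 _] Ds0] : exists2 c, c \in `[0, M] & D c = 0.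
  apply: IVT => //; last by rewrite ge_min D0/= le_max DM orbT.
  apply: continuous_subspaceT => x; apply: cvgB.
    apply: cvgMr; apply: (@continuous_comp _ _ _ ( *%R l2) cosh).
      exact: mulrl_continuous.
    exact: continuous_cosh.
  apply: cvgMr; apply: (@continuous_comp _ _ _ ( *%R l1) cosh).
    exact: mulrl_continuous.
  exact: continuous_cosh.
have s0E : E2 * cosh (l2 * s0) = E1 * cosh (l1 * s0) by apply/eqP; rewrite -subr_eq0; apply/eqP.
exists s0 => s; rewrite (ger0_norm s00) -!(shift_kernel_abs _ s)//; last lra.
have := normr_ge0 s; move: `|s| => {}s sge0.
rewrite /shift_kernel -/E1 -/E2; have c0 := cosh_gt0 (l1 * s0).
(* Multiplying by [cosh (l1 s0)] and using equality at [s0] removes [E1]; total positivity on the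
   ordered pair of [s] and [s0] remains. *)
split=> ss; rewrite -(ler_pM2r c0).
  rewrite [leRHS]mulrAC -s0E -[leLHS]mulrA -[leRHS]mulrA ler_pM2l//; exact: cosh_tp2.
rewrite [leLHS]mulrAC -s0E -[leLHS]mulrA -[leRHS]mulrA ler_pM2l//.
exact: cosh_tp2.
Qed.

End HyperbolicKernel.

Lemma half_adde (R : realType) (x : \bar R) : ((2^-1)%:E * (x + x) = x)%E.
Proof.
case: x => [r| |]; first by rewrite -EFinD -EFinM; congr EFin; field.
  by rewrite gt0_muley// lte_fin invr_gt0.
by rewrite gt0_muleNy// lte_fin invr_gt0.
Qed.

(** * Anderson-type inequality along a line *)

Section ShiftMonotone.
Import numFieldNormedType.Exports.
Context {R : realType} {n : nat}.
Local Notation W := (g_sigma_algebraType (@rects R n)).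
Variable mu : probability W R.
Hypothesis muN : std_normal_law mu.
Local Open Scope ereal_scope.

Lemma measurable_inner (m : 'cV[R]_n) :
  measurable_fun [set: W] (fun z : W => inner m z).
Proof.
apply: measurable_sum => i.
by apply: measurable_funM => //; exact: measurable_coord.
Qed.

Lemma measurable_line d (T : measurableType d) (f : T -> R) (g : T -> W) (m : 'cV[R]_n) :
  measurable_fun [set: T] f -> measurable_fun [set: T] g ->
  measurable_fun [set: T] (fun x => ((g x : 'cV[R]_n) + f x *: m)%R : W).
Proof.
move=> mf mg; apply: measurable_cVP => j; under eq_fun do rewrite !mxE.
apply: measurable_funD; last exact: measurable_funM.
exact: (measurableT_comp (measurable_coord j)).
Qed.

Lemma measurable_shift_kernel N l (m : 'cV[R]_n) :
  measurable_fun [set: W] (fun z : W => shift_kernel N l (inner m z)).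
Proof.
apply: measurable_funM => //; apply: (@measurableT_comp _ _ _ _ _ _ (@cosh R)).
  apply: continuous_measurable_fun; exact: continuous_cosh.
by apply: measurable_funM => //; exact: measurable_inner.
Qed.

(** Cameron-Martin for the shifts [l m] and [- l m]: the mean of the two likelihood ratios is the
    hyperbolic kernel. *)
Lemma ge0_integral_shift_kernel (m : 'cV[R]_n) (l : R) (F : W -> R) :
  measurable_fun [set: W] F -> (forall z, (0 <= F z)%R) ->
  \int[mu]_z (F z * shift_kernel (sqnorm m) l (inner m z))%:E =
  (2^-1)%:E * (\int[mu]_z (F ((z : 'cV[R]_n) + l *: m)%R)%:E
             + \int[mu]_z (F ((z : 'cV[R]_n) + (- l) *: m)%R)%:E).
Proof.
move=> mF F0.
have mEF : measurable_fun [set: W] (EFin \o F) by exact/measurable_EFinP.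
have mh r : measurable_fun [set: W]
    (fun z => (F z)%:E * (expR (inner (r *: m) z - sqnorm (r *: m) / 2))%:E).
  apply: emeasurable_funM => //; apply/measurable_EFinP.
  apply: measurableT_comp => //; apply: measurable_funB => //.
  exact: measurable_inner.
have h0 r z : 0 <= (F z)%:E * (expR (inner (r *: m) z - sqnorm (r *: m) / 2))%:E.
  by rewrite mule_ge0 ?lee_fin ?expR_ge0.
rewrite !(ge0_integral_shift muN _ mEF)//=.
rewrite -ge0_integralD//= -ge0_integralZl//=.
- apply: eq_integral => z _; rewrite -!EFinM -?EFinD -?EFinM; congr EFin.
  rewrite !innerZl !sqnormZ sqrrN /shift_kernel /cosh !expRD !mulNr.
  by field.
- exact: emeasurable_funD.
- by move=> z _; exact: adde_ge0.
Qed.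

(** [F] stands for [phi(R^2) V] and [m] for [X beta]. The integrable envelope [K], constant along
    [m], keeps [F] integrable even after its component along [m] has been replaced. *)
Variables (m : 'cV[R]_n) (F K : W -> R).
Hypotheses (mF : measurable_fun [set: W] F) (F0 : forall z, (0 <= F z)%R).
Hypothesis FN : forall z : 'cV[R]_n, F (- z)%R = F z.
Hypothesis F_line : forall (x : 'cV[R]_n) (r1 r2 : R), inner m x = 0%R ->
  (`|r1| <= `|r2|)%R -> (F (x + r1 *: m) <= F (x + r2 *: m))%R.
Hypothesis mK : measurable_fun [set: W] K.
Hypothesis FK : forall z, (F z <= K z)%R.
Hypothesis K_line : forall (x : 'cV[R]_n) (r : R), K (x + r *: m)%R = K x.
Hypothesis Koo : \int[mu]_z (K z)%:E < +oo.

Lemma ge0_integral_shift_sym (l : R) :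
  \int[mu]_z (F ((z : 'cV[R]_n) + (- l) *: m)%R)%:E =
  \int[mu]_z (F ((z : 'cV[R]_n) + l *: m)%R)%:E.
Proof.
rewrite -(ge0_integral_opp muN (F := fun z : W => (F ((z : 'cV[R]_n) + (- l) *: m)%R)%:E)).
- apply: eq_integral => z _; congr EFin.
  by rewrite -[LHS]FN opprD opprK scaleNr opprK.
- apply/measurable_EFinP; apply: (measurableT_comp mF).
  exact: (measurable_line _ (measurable_cst (- l)%R) (@measurable_id _ W setT)).
- by move=> z; rewrite lee_fin.
Qed.

(* Only the component of [z] along [m] is shifted, so replacing that component
   by the level [s0] at which the two kernels cross makes [F] constant under the
   shifts while [(F - F0) * (k2 - k1) >= 0]. *)
Lemma le_integral_shift (l1 l2 : R) : (0 <= l1 <= l2)%R ->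
  \int[mu]_z (F ((z : 'cV[R]_n) + l1 *: m)%R)%:E <=
  \int[mu]_z (F ((z : 'cV[R]_n) + l2 *: m)%R)%:E.
Proof.
move=> /andP[l10 l12].
(* Both shifts are trivial when [m = 0]; otherwise [sqnorm m] may be divided by. *)
case: (boolP (m == 0%R)) => [/eqP mz|m0].
  by rewrite le_eqVlt; apply/orP; left; apply/eqP/eq_integral => z _; rewrite mz !scaler0.
set N := sqnorm m.
have Np : (0 < N)%R by rewrite lt0r sqnorm_eq0 m0 sqnorm_ge0.
have [s0 cross] := shift_kernel_crossing (ltW Np) l10 l12.
(* The argument of [F] is [z] moved along [m] until its inner product with [m] equals [s0]. *)
pose Fs (z : W) : R := F ((z : 'cV[R]_n) + ((s0 - inner m z) / N) *: m)%R.
have mFs : measurable_fun [set: W] Fs.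
  apply: (measurableT_comp mF); apply: measurable_line => //.
  apply: measurable_funM => //; apply: measurable_funB => //; exact: measurable_inner.
have Fs0 z : (0 <= Fs z)%R by exact: F0.
have Fs_line (z : 'cV[R]_n) r : Fs (z + r *: m)%R = Fs z.
  rewrite /Fs innerDr innerZr inner_sqnorm -/N -addrA -scalerDl.
  congr F; congr (_ + _ *: _)%R; field; exact: lt0r_neq0.
have intFs : \int[mu]_z (Fs z)%:E < +oo.
  apply: le_lt_trans Koo; apply: ge0_le_integral => //.
  - by move=> z _; rewrite lee_fin.
  - exact/measurable_EFinP.
  - exact/measurable_EFinP.
  - by move=> z _; rewrite lee_fin -(K_line z ((s0 - inner m z) / N)) FK.
have intFsk l : \int[mu]_z (Fs z * shift_kernel N l (inner m z))%:E = \int[mu]_z (Fs z)%:E.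
  rewrite ge0_integral_shift_kernel//.
  under eq_integral do rewrite Fs_line.
  under [X in _ * (_ + X)]eq_integral do rewrite Fs_line.
  exact: half_adde.
have intFk l : \int[mu]_z (F z * shift_kernel N l (inner m z))%:E =
    \int[mu]_z (F ((z : 'cV[R]_n) + l *: m)%R)%:E.
  rewrite ge0_integral_shift_kernel// ge0_integral_shift_sym.
  exact: half_adde.
have mGk (G : W -> R) l : measurable_fun [set: W] G ->
    measurable_fun [set: W] (fun z => (G z * shift_kernel N l (inner m z))%:E).
  by move=> mG; apply/measurable_EFinP/measurable_funM => //; exact: measurable_shift_kernel.
have Gk0 (G : W -> R) l z : (0 <= G z)%R ->
    0 <= (G z * shift_kernel N l (inner m z))%:E.
  by move=> ?; rewrite lee_fin mulr_ge0// shift_kernel_ge0.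
(* Integrated form of the sign relation between [F - Fs] and the difference of kernels, arranged as
   sums of nonnegative terms to avoid subtraction. *)
have : \int[mu]_z (F z * shift_kernel N l1 (inner m z))%:E
       + \int[mu]_z (Fs z * shift_kernel N l2 (inner m z))%:E <=
       \int[mu]_z (F z * shift_kernel N l2 (inner m z))%:E
       + \int[mu]_z (Fs z * shift_kernel N l1 (inner m z))%:E.
  rewrite -[leLHS]ge0_integralD; [|exact: measurableT|by move=> z _; exact: Gk0
    |exact: mGk|by move=> z _; exact: Gk0|exact: mGk].
  rewrite -[leRHS]ge0_integralD; [|exact: measurableT|by move=> z _; exact: Gk0
    |exact: mGk|by move=> z _; exact: Gk0|exact: mGk].
  apply: ge0_le_integral => //.
  - by move=> z _; apply: adde_ge0; exact: Gk0.
  - by apply: emeasurable_funD; exact: mGk.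
  - by apply: emeasurable_funD; exact: mGk.
  move=> z _; rewrite -!EFinD lee_fin.
  set s := inner m z; have [k21 k12] := cross s.
  (* [x] is the part of [z] orthogonal to [m]. Both [F z] and [Fs z] are values of [F] on the line
     through [x], at parameters [s / N] and [s0 / N]. *)
  pose x : 'cV[R]_n := ((z : 'cV[R]_n) - (s / N) *: m)%R.
  have xm : inner m x = 0%R.
    rewrite /x -scaleNr innerDr innerZr inner_sqnorm -/N -/s.
    by field; exact: lt0r_neq0.
  have Fz : F z = F (x + (s / N) *: m)%R by rewrite /x subrK.
  have Fsz : Fs z = F (x + (s0 / N) *: m)%R.
    rewrite /Fs /x -/s; congr F.
    by rewrite -addrA -scaleNr -scalerDl; congr (_ + _ *: _)%R; ring.
  have absN (r : R) : (`|r / N| = `|r| / N)%R by rewrite normrM normfV (gtr0_norm Np).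
  rewrite Fz Fsz.
  have [ss|/ltW ss] := leP `|s|%R `|s0|%R.
    have := k21 ss; have : (F (x + (s / N) *: m) <= F (x + (s0 / N) *: m))%R.
      by apply: F_line => //; rewrite !absN ler_pM2r ?invr_gt0.
    move: (F _) (F _) (shift_kernel _ _ _) (shift_kernel _ _ _) => a b c d; nra.
  have := k12 ss; have : (F (x + (s0 / N) *: m) <= F (x + (s / N) *: m))%R.
    by apply: F_line => //; rewrite !absN ler_pM2r ?invr_gt0.
  move: (F _) (F _) (shift_kernel _ _ _) (shift_kernel _ _ _) => a b c d; nra.
(* Both kernels give [Fs] the same finite integral, which cancels. *)
rewrite !intFsk !intFk leeD2rE// ge0_fin_numE//.
by apply: integral_ge0 => z _; rewrite lee_fin.
Qed.

End ShiftMonotone.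

(** * Stein loss under a scale mixture *)

Section SteinLoss.
Context {R : realType}.
Implicit Types x p : R.

Definition stein x : R := x - ln x - 1.

(** For positive [x] this is [ln x < x]; at [0] the convention [ln 0 = 0] gives exactly [-1]. The
    bound keeps negative parts of losses integrable. *)
Lemma stein_ge x : 0 <= x -> -1 <= stein x.
Proof.
rewrite le_eqVlt => /orP[/eqP <-|x0]; first by rewrite /stein ln0// !subr0 sub0r.
have := ln_sublinear x0; rewrite /stein; lra.
Qed.

(* The case split is there because [ln 0 = 0]. *)
Lemma stein_scale p x : 0 < p -> 0 <= x ->
  stein (p * x) = stein x + (p - 1) * x - (if 0 < x then ln p else 0).
Proof.
move=> p0; rewrite le_eqVlt => /orP[/eqP <-|x0].
  by rewrite ltxx mulr0; ring.
by rewrite x0 /stein lnM ?posrE//; ring.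
Qed.

Lemma measurable_stein : measurable_fun [set: R] stein.
Proof. by apply: measurable_funB => //; apply: measurable_funB. Qed.

(** The logarithm of [x] cancels in the difference, leaving an affine bound in [x]. Loss differences
    are thus integrable without any assumption on the losses themselves. *)
Lemma stein_scale_le (a b p x : R) : 0 < a -> a <= p <= b -> 0 <= x ->
  `|stein (p * x) - stein x| <= (b + 1) * x + (`|ln a| + `|ln b|).
Proof.
move=> a0 /andP[ap pb] x0; have p0 : 0 < p by lra.
rewrite stein_scale// (_ : _ - stein x = (p - 1) * x - (if 0 < x then ln p else 0)); last first.
  by ring.
apply: (le_trans (ler_normB _ _)); apply: lerD.
  by rewrite normrM (ger0_norm x0) ler_wpM2r// ler_norml; lra.
case: ifP => _; last by rewrite normr0 addr_ge0.
have : ln a <= ln p by rewrite ler_ln ?posrE.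
have : ln p <= ln b by rewrite ler_ln ?posrE//; lra.
move=> h1 h2; have := ler_norm (ln b); have := lerNnormlW (lexx `|ln a|).
have := normr_ge0 (ln a); have := normr_ge0 (ln b).
by move=> *; rewrite ler_norml; lra.
Qed.

End SteinLoss.

Section Integrability.
Context d {T : measurableType d} {R : realType} (mu : probability T R).
Local Open Scope ereal_scope.

Lemma integral_cst1 : \int[mu]_x (1%:E : \bar R) = 1.
Proof. rewrite (integral_cst mu measurableT 1) mul1e; exact: probability_setT. Qed.

(** The negative part is at most [1] on a probability space, so a finite integral bounds the
    positive part as well. *)
Lemma integrable_bounded_below (f : T -> R) :
  measurable_fun [set: T] f -> (forall x, (-1 <= f x)%R) ->
  \int[mu]_x (f x)%:E < +oo -> mu.-integrable [set: T] (EFin \o f).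
Proof.
move=> mf f1 foo.
have mEf : measurable_fun [set: T] (EFin \o f) by exact/measurable_EFinP.
have neg1 : \int[mu]_x (EFin \o f)^\- x <= 1.
  rewrite -(@probability_setT _ _ _ mu) -[leRHS]mul1e -integral_cst//.
  apply: ge0_le_integral => //; first exact: measurable_funeneg.
  move=> x _; rewrite funenegE ge_max -EFinN lee_fin lee01 andbT.
  by rewrite lerNl f1.
have negfin : \int[mu]_x (EFin \o f)^\- x \is a fin_num.
  by rewrite ge0_fin_numE ?integral_ge0// (le_lt_trans neg1)// ltry.
apply/integrableP; split => //.
rewrite -[X in \int[mu]_x X x]/(abse \o (EFin \o f)) fune_abse.
rewrite ge0_integralD//; [|exact: measurable_funepos|exact: measurable_funeneg].
rewrite lte_add_pinfty//; last by rewrite -ge0_fin_numE ?integral_ge0.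
have /lt_le_trans : \int[mu]_x (EFin \o f)^\+ x < +oo + \int[mu]_x (EFin \o f)^\- x.
  by rewrite -(lteBlDr _ _ negfin) -integralE.
by apply; rewrite leey.
Qed.

End Integrability.

(** * Averaging the loss difference over the random scale *)

Section Mixture.
Context d1 d2 {T1 : measurableType d1} {T2 : measurableType d2} {R : realType}.
(** The product of [P] and [mu] encodes the independence of [tau] and [Z]. [psi t] stands for
    [phi(R^2)] when [tau = t], and [V] for [RSS / (n - p - 1)] computed from [Z]. *)
Variables (P : probability T1 R) (mu : probability T2 R).
Variables (tau : T1 -> R) (V : T2 -> R) (psi : R -> T2 -> R) (a b : R).
Hypotheses (mtau : measurable_fun [set: T1] tau) (tau0 : forall w, 0 < tau w).
Hypothesis tau2 : (\int[P]_w (tau w ^+ 2)%:E = 1)%E.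
Hypotheses (mV : measurable_fun [set: T2] V) (V0 : forall z, 0 <= V z).
Hypothesis Voo : (\int[mu]_z (V z)%:E < +oo)%E.
Hypothesis mpsi : measurable_fun [set: R * T2] (fun tz => psi tz.1 tz.2).
Hypotheses (a0 : 0 < a) (psiab : forall t z, a <= psi t z <= b).
Hypothesis psi_normal : forall t, 0 < t ->
  (\int[mu]_z (stein (psi t z * V z))%:E <= \int[mu]_z (stein (V z))%:E)%E.
Hypothesis psi_mono : forall t1 t2, 0 < t1 -> t1 <= t2 ->
  (\int[mu]_z (psi t2 z * V z)%:E <= \int[mu]_z (psi t1 z * V z)%:E)%E.
Local Open Scope ereal_scope.

Let intV : mu.-integrable [set: T2] (EFin \o V).
Proof.
apply: integrable_bounded_below => // z.
by rewrite (le_trans _ (V0 z))// lerN10.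
Qed.

Let mpsi2 t : measurable_fun [set: T2] (psi t).
Proof. exact: (measurable_fun_pair2 t mpsi). Qed.

Let psi_lb t z : (a <= psi t z)%R. Proof. by have /andP[] := psiab t z. Qed.

Let psi_ub t z : (psi t z <= b)%R. Proof. by have /andP[] := psiab t z. Qed.

Let psi_gt0 t z : (0 < psi t z)%R. Proof. exact: lt_le_trans a0 (psi_lb t z). Qed.

Let b0 : (0 < b)%R.
Proof. exact: lt_le_trans (psi_gt0 0%R point) (psi_ub _ _). Qed.

Let intpsiV t : mu.-integrable [set: T2] (fun z => (psi t z * V z)%:E).
Proof.
apply: (@le_integrable _ _ _ mu _ measurableT _ (fun z => b%:E * (V z)%:E)).
- by apply/measurable_EFinP; exact: measurable_funM.
- move=> z _; rewrite -EFinM !abse_EFin lee_fin !normrM ler_wpM2r//.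
  by rewrite !ger0_norm ?psi_ub// ltW.
- exact: integrableZl.
Qed.

Let int_cst d (T : measurableType d) (Q : probability T R) (c : R) :
  Q.-integrable [set: T] (cst c%:E).
Proof.
by apply: finite_measure_integrable_cst.
Qed.

Let int_stein_scale d (T : measurableType d) (Q : probability T R)
    (g q : T -> R) : Q.-integrable [set: T] (EFin \o g) ->
  (forall x, (0 <= g x)%R) -> measurable_fun [set: T] q ->
  (forall x, (a <= q x <= b)%R) ->
  Q.-integrable [set: T] (fun x => (stein (q x * g x) - stein (g x))%:E).
Proof.
move=> ig g0 mq qab; have mg : measurable_fun [set: T] g.
  by apply/measurable_EFinP; exact: measurable_int ig.
apply: (@le_integrable _ _ _ Q _ measurableT _
    (fun x => (b + 1)%:E * (g x)%:E + (`|ln a| + `|ln b|)%:E)).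
- apply/measurable_EFinP/measurable_funB; last exact: (measurableT_comp measurable_stein).
  by apply: (measurableT_comp measurable_stein); exact: measurable_funM.
- move=> x _; rewrite -EFinM -EFinD !abse_EFin lee_fin.
  by apply: le_trans (stein_scale_le a0 (qab x) (g0 x)) (ler_norm _).
- by apply: integrableD => //; [exact: integrableZl|exact: int_cst].
Qed.

(** The losses at scales [t] and [1] differ by a multiple of [V] and a bounded term, both
    integrable. *)
Let int_stein_level t : (0 < t)%R ->
  mu.-integrable [set: T2] (fun z => (stein (t ^+ 2 * V z))%:E) ->
  mu.-integrable [set: T2] (fun z => (stein (V z))%:E).
Proof.
move=> t0 it; have t20 : (0 < t ^+ 2)%R by exact: exprn_gt0.
pose c := fun z => if (0 < V z)%R then ln (t ^+ 2) else 0%R.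
have mc : measurable_fun [set: T2] c.
  apply: measurable_fun_ifT => //; exact: measurable_fun_ltr.
have ic : mu.-integrable [set: T2] (EFin \o c).
  apply: (@le_integrable _ _ _ mu _ measurableT _ (cst (`|ln (t ^+ 2)|)%:E)).
  - exact/measurable_EFinP.
  - move=> z _; rewrite /c /= lee_fin normr_id.
    by case: ifP; rewrite ?normr0.
  - exact: int_cst.
have -> : (fun z => (stein (V z))%:E) =
    (fun z => (stein (t ^+ 2 * V z))%:E - (t ^+ 2 - 1)%:E * (V z)%:E + (c z)%:E).
  apply/funext => z; rewrite -EFinM -EFinB -EFinD; congr EFin.
  by rewrite stein_scale// /c; ring.
apply: integrableD => //; apply: integrableB => //; exact: integrableZl.
Qed.

Let Vtau (x : T1 * T2) : R := (tau x.1 ^+ 2 * V x.2)%R.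

Let mtau2 : measurable_fun [set: T1] (fun w => (tau w ^+ 2)%R).
Proof. exact: measurable_funX. Qed.

Let mtau1 : measurable_fun [set: T1 * T2] (fun x => tau x.1).
Proof. exact: (measurableT_comp mtau measurable_fst). Qed.

Let mV2 : measurable_fun [set: T1 * T2] (fun x => V x.2).
Proof. exact: (measurableT_comp mV measurable_snd). Qed.

Let mVtau : measurable_fun [set: T1 * T2] Vtau.
Proof. by apply: measurable_funM => //; exact: measurable_funX. Qed.

Let Vtau0 x : (0 <= Vtau x)%R.
Proof. by rewrite mulr_ge0// sqr_ge0. Qed.

Let intVtau : (P \x mu).-integrable [set: T1 * T2] (EFin \o Vtau).
Proof.
apply: integrable_bounded_below => //.
  by move=> x; rewrite (le_trans _ (Vtau0 x))// lerN10.
rewrite (@fubini_tonelli1 _ _ _ _ _ P mu (EFin \o Vtau))//; last first.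
  exact: (measurable_EFinP _ _).2 mVtau.
rewrite (eq_integral (fun w => (tau w ^+ 2)%:E * \int[mu]_z (V z)%:E)); last first.
  move=> w _; rewrite /fubini_F -ge0_integralZl ?lee_fin ?sqr_ge0//.
  - exact/measurable_EFinP.
  - by move=> z _; rewrite lee_fin.
rewrite ge0_integralZr//; last 3 first.
- exact/measurable_EFinP.
- by move=> w _; rewrite lee_fin sqr_ge0.
- by apply: integral_ge0 => z _; rewrite lee_fin.
by rewrite tau2 mul1e.
Qed.

Let psit (x : T1 * T2) : R := psi (tau x.1) x.2.

Let mpsit : measurable_fun [set: T1 * T2] psit.
Proof.
exact: (measurableT_comp mpsi (measurable_fun_pair mtau1 measurable_snd)).
Qed.

Lemma stein_mixture_le :
  \int[P \x mu]_x (stein (psit x * Vtau x))%:E <= \int[P \x mu]_x (stein (Vtau x))%:E.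
Proof.
have mS : measurable_fun [set: T1 * T2] (fun x => stein (Vtau x)).
  exact: (measurableT_comp measurable_stein).
(* An infinite risk of the unbiased estimator leaves nothing to prove. *)
have [foo|] := ltP (\int[P \x mu]_x (stein (Vtau x))%:E) +oo; last first.
  by rewrite leye_eq => /eqP ->; rewrite leey.
have iS : (P \x mu).-integrable [set: T1 * T2] (fun x => (stein (Vtau x))%:E).
  by apply: integrable_bounded_below => // x; exact: stein_ge.
(* By Fubini some [w] has finite conditional risk, so the normal risk is finite. *)
have iSV : mu.-integrable [set: T2] (fun z => (stein (V z))%:E).
  have [N [mN PN0 subN]] := ae_integrable1 iS.
  have [w Nw] : exists w, ~ N w.
    apply: contrapT => /forallNP nN; have NT : N = setT.
      by apply/seteqP; split => // w _; apply: contrapT; exact: nN.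
    have PN1 : P N = 1 by rewrite NT; exact: probability_setT.
    by have /eqP := etrans (esym PN1) PN0; rewrite onee_eq0.
  apply: (int_stein_level (tau0 w)); apply: contrapT => nw; apply: Nw.
  exact: subN.
pose D t z := (stein (psi t z * V z) - stein (V z))%R.
have iD t : mu.-integrable [set: T2] (fun z => (D t z)%:E).
  exact: int_stein_scale.
have D_le0 t : (0 < t)%R -> \int[mu]_z (D t z)%:E <= 0.
  move=> t0; have := psi_normal t0.
  have -> : (fun z => (stein (psi t z * V z))%:E) = (fun z => (stein (V z))%:E + (D t z)%:E).
    by apply/funext => z; rewrite -EFinD /D subrKC.
  rewrite integralD// -[leRHS]adde0 leeD2lE//.
  exact: integrable_fin_num iSV.
pose D' (x : T1 * T2) := (stein (psit x * Vtau x) - stein (Vtau x))%R.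
have iD' : (P \x mu).-integrable [set: T1 * T2] (fun x => (D' x)%:E).
  by apply: int_stein_scale => // x; exact: psiab.
have -> : \int[P \x mu]_x (stein (psit x * Vtau x))%:E =
    \int[P \x mu]_x ((stein (Vtau x))%:E + (D' x)%:E).
  by apply: eq_integral => x _; rewrite -EFinD /D' subrKC.
rewrite integralD// -[leRHS]adde0 leeD2lE; last exact: integrable_fin_num iS.
pose G t := fine (\int[mu]_z (psi t z * V z)%:E).
have GE t : \int[mu]_z (psi t z * V z)%:E = (G t)%:E.
  by rewrite /G fineK//; exact: integrable_fin_num (intpsiV t).
pose v := fine (\int[mu]_z (V z)%:E).
have vE : \int[mu]_z (V z)%:E = v%:E by rewrite fineK//; exact: integrable_fin_num intV.
(* Replacing [G (tau w)] by the constant [G 1] makes the bound a fixed multiple of [tau^2 - 1],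
   whose mean is zero. *)
have D'_le w : \int[mu]_z (D' (w, z))%:E <= ((tau w ^+ 2 - 1) * (G 1 - v))%:E.
  have t0 := tau0 w; set t := tau w in t0 *.
  have -> : \int[mu]_z (D' (w, z))%:E =
      \int[mu]_z ((D t z)%:E + ((t ^+ 2 - 1)%:E * ((psi t z * V z)%:E - (V z)%:E))).
    apply: eq_integral => z _; rewrite -EFinB -EFinM -EFinD; congr EFin.
    have p0 := psi_gt0 t z.
    rewrite /D' /D /psit /Vtau /= -/t !(stein_scale p0)//; last by rewrite mulr_ge0 ?sqr_ge0.
    (* Positivity of [t^2 V] and of [V] is the same condition, so the logarithms of [psi] cancel
       under either case. *)
    rewrite pmulr_rgt0 ?exprn_gt0//.
    move: (V z) (psi t z) (ln _) (stein (V z)) (stein _) => x q c s1 s2.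
    by case: ifP => _; ring.
  have iB : mu.-integrable [set: T2] (fun z => (psi t z * V z)%:E - (V z)%:E).
    exact: integrableB.
  rewrite integralD//; last exact: integrableZl.
  rewrite integralZl// integralB// GE vE -EFinB -EFinM.
  apply: le_trans (leeD (D_le0 _ t0) (lexx _)) _; rewrite add0e lee_fin.
  (* [t^2 - 1] and [G t - G 1] have opposite signs on both sides of [t = 1]. *)
  have [t1|/ltW t1] := leP t 1%R.
    have : (G 1 <= G t)%R by rewrite -lee_fin -!GE; exact: psi_mono.
    have : (t ^+ 2 <= 1)%R by rewrite exprn_ile1// ltW.
    nra.
  have : (G t <= G 1)%R by rewrite -lee_fin -!GE; exact: psi_mono.
  have : (1 <= t ^+ 2)%R by rewrite exprn_ege1.
  nra.
have itau2 : P.-integrable [set: T1] (fun w => (tau w ^+ 2)%:E).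
  apply: integrable_bounded_below => //.
    by move=> w; rewrite (le_trans _ (sqr_ge0 (tau w)))// lerN10.
  by rewrite tau2 ltry.
have itau21 : P.-integrable [set: T1] (fun w => (tau w ^+ 2)%:E - 1).
  by apply: integrableB => //; exact: (int_cst P 1).
rewrite -(integral12_prod_meas1 iD').
apply: (@le_trans _ _ (\int[P]_w ((G 1 - v)%:E * ((tau w ^+ 2)%:E - 1)))).
  apply: le_integral => //; [exact: integrable_fubini_F|exact: integrableZl|].
  by move=> w _; rewrite -EFinB -EFinM mulrC; exact: D'_le.
rewrite integralZl// integralB//; last exact: (int_cst P 1).
by rewrite tau2 integral_cst1 subee// mule0.
Qed.

End Mixture.

(** * Laws of the statistics *)

Section Regressors.
Import numFieldNormedType.Exports.
Context {R : realType}.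
Local Notation W n := (g_sigma_algebraType (@rects R n)).

Lemma measurable_mulmx k n (M : 'M[R]_(k, n)) :
  measurable_fun [set: W n] (fun z : W n => M *m (z : 'cV[R]_n) : W k).
Proof.
apply: measurable_cVP => i; under eq_fun do rewrite mxE.
apply: measurable_sum => j.
by apply: measurable_funM => //; exact: measurable_coord.
Qed.

Lemma measurable_sqnorm n : measurable_fun [set: W n] (fun z : W n => sqnorm (z : 'cV[R]_n)).
Proof.
by apply: measurable_sum => i; apply: measurable_funX; exact: measurable_coord.
Qed.

Lemma measurable_centered n :
  measurable_fun [set: W n] (fun z : W n => centered_y (z : 'cV[R]_n) : W n).
Proof.
apply: measurable_cVP => i; under eq_fun do rewrite !mxE.
apply: measurable_funB; first exact: measurable_coord.
apply: measurable_funM => //; apply: measurable_funM => //.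
by apply: measurable_sum => j; exact: measurable_coord.
Qed.

Lemma measurable_proj_centered k n (M : 'M[R]_(k, n)) :
  measurable_fun [set: W n] (fun z : W n => sqnorm (M *m centered_y (z : 'cV[R]_n))).
Proof.
apply: (measurableT_comp (@measurable_sqnorm k)).
exact: (measurableT_comp (measurable_mulmx M) (@measurable_centered n)).
Qed.

Lemma measurable_RSS n p (X : 'M[R]_(n, p)) :
  measurable_fun [set: W n] (fun z : W n => RSS X z).
Proof. exact: measurable_proj_centered. Qed.

Lemma measurable_Rsq n p (X : 'M[R]_(n, p)) :
  measurable_fun [set: W n] (fun z : W n => Rsq X z).
Proof.
apply: measurable_funM; first exact: measurable_proj_centered.
rewrite (_ : (fun _ => _) = fun z : W n => sqnorm (centered_y (z : 'cV[R]_n)) `^ (-1)).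
  apply: (measurableT_comp (measurable_powR _)).
  exact: (measurableT_comp (@measurable_sqnorm n) (@measurable_centered n)).
by apply/funext => z; rewrite powR_inv1// sqnorm_ge0.
Qed.

Lemma sqnorm_centered_le n (y : 'cV[R]_n) : (0 < n)%N ->
  sqnorm (centered_y y) <= sqnorm y.
Proof.
move=> n0; have nn : n%:R != 0 :> R by rewrite pnatr_eq0 -lt0n.
have yE : y = centered_y y + mean y *: ones R n by rewrite /centered_y subrK.
rewrite [leRHS](_ : _ = sqnorm (centered_y y + mean y *: ones R n)); last by rewrite -yE.
rewrite sqnormD_orth ?lerDl ?sqnorm_ge0//; apply/inner_eq0.
rewrite innerZr innerC /centered_y -scaleN1r innerDr !innerZr.
have -> : inner (ones R n) y = \sum_(i < n) y i ord0.
  by apply: eq_bigr => i _; rewrite mxE mul1r.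
have -> : inner (ones R n) (ones R n) = n%:R.
  rewrite /inner -[in RHS](card_ord n) -sumr_const.
  by apply: eq_bigr => i _; rewrite !mxE mul1r.
by rewrite /mean mulfVK// mulN1r subrr mulr0.
Qed.

(** Centering and the residual projection are both orthogonal projections; the bound serves to
    integrate [RSS]. *)
Lemma RSS_le_sqnorm n p (X : 'M[R]_(n, p)) (y : 'cV[R]_n) : (0 < n)%N ->
  (forall j : 'I_p, \sum_(i < n) X i j = 0) -> \rank X = p ->
  RSS X y <= sqnorm y.
Proof.
move=> n0 Xc rX; apply: le_trans (sqnorm_centered_le y n0).
have -> : centered_y y = hat X *m centered_y y + (1%:M - hat X) *m centered_y y.
  by rewrite mulmxBl mul1mx subrKC.
rewrite sqnormD_orth ?lerDr ?sqnorm_ge0//.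
rewrite trmx_mul (hat_sym (X := X)) -mulmxA (mulmxA (hat X)) [hat X *m (_ - _)]mulmxBr.
by rewrite mulmx1 (hat_idem rX) subrr mul0mx mulmx0.
Qed.

(** For [x >= 0], [expR x = expR (x / 2)^2 >= (1 + x / 2)^2 >= x^2 / 4], and
    [expR x <= 2 cosh x]. *)
Lemma sqr_le_cosh (x : R) : x ^+ 2 <= 8 * cosh x.
Proof.
rewrite -cosh_abs -real_normK ?num_real//; have := normr_ge0 x.
move: `|x| => {}x x0.
have h1 : 1 + x / 2 <= expR (x / 2) by exact: expR_ge1Dx.
have h2 : expR x = expR (x / 2) ^+ 2 by rewrite -expRM_natr; congr expR; field.
have h3 : (1 + x / 2) ^+ 2 <= expR x by rewrite h2 ler_sqr ?nnegrE ?expR_ge0//; lra.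
have h4 := expR_ge0 (- x); rewrite /cosh; nra.
Qed.

(** Each squared coordinate is dominated by a multiple of a shift kernel, and the kernel has
    integral [1]: apply the averaged Cameron-Martin formula to the constant function [1]. *)
Lemma integral_sqnorm_lty n (mu : probability (W n) R) : std_normal_law mu ->
  (\int[mu]_z (sqnorm (z : 'cV[R]_n))%:E < +oo)%E.
Proof.
move=> muN; rewrite /sqnorm; under eq_integral do rewrite -sumEFin.
rewrite ge0_integral_sum//; last 2 first.
- move=> i; apply/measurable_EFinP/measurable_funX; exact: measurable_coord.
- by move=> i z _; rewrite lee_fin sqr_ge0.
apply: lte_sum_pinfty => i _; pose e : 'cV[R]_n := delta_mx i ord0.
have ei (z : 'cV[R]_n) : inner e z = z i ord0.
  rewrite /inner (bigD1 i)//= big1 ?addr0 => [|j ji]; first by rewrite mxE !eqxx mul1r.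
  by rewrite mxE (negbTE ji) mul0r.
have k1 : (\int[mu]_z (cst 1 z * shift_kernel (sqnorm e) 1 (inner e z))%:E = 1)%E.
  rewrite (ge0_integral_shift_kernel muN e 1 (F := cst 1))//.
  transitivity ((2^-1 : R)%:E * (1 + 1))%E; last by rewrite half_adde.
  by congr (_ * (_ + _))%E; exact: integral_cst1.
have mk : measurable_fun [set: W n]
    (fun z => (cst 1 z * shift_kernel (sqnorm e) 1 (inner e z))%:E).
  by apply/measurable_EFinP/measurable_funM => //; exact: measurable_shift_kernel.
(* The factor [8] comes from [sqr_le_cosh]; the exponential undoes the normalization of the kernel
   at [l = 1]. *)
pose c := 8 * expR (sqnorm e / 2).
apply: (@le_lt_trans _ _ (\int[mu]_z
    (c%:E * (cst 1 z * shift_kernel (sqnorm e) 1 (inner e z))%:E))%E).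
  apply: ge0_le_integral => //.
  - by move=> z _; rewrite lee_fin sqr_ge0.
  - by apply/measurable_EFinP/measurable_funX; exact: measurable_coord.
  - exact: emeasurable_funM.
  - move=> z _; rewrite -EFinM lee_fin ei /shift_kernel /c /= expr1n !mul1r.
    by rewrite mulrA -(mulrA 8) -expRD subrr expR0 mulr1 sqr_le_cosh.
rewrite ge0_integralZl//; last 2 first.
- by move=> z _; rewrite lee_fin mul1r shift_kernel_ge0.
- by rewrite lee_fin mulr_ge0// expR_ge0.
by rewrite k1 mule1 ltry.
Qed.

End Regressors.

(** * Joint law of the scale and the Gaussian vector *)

Section Law.
Import numFieldNormedType.Exports.
Context {R : realType}.
Local Notation W n := (g_sigma_algebraType (@rects R n)).
Local Open Scope ereal_scope.

(** Positive and negative parts are transported separately, which covers Stein losses that take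
    negative values or fail to be integrable. *)
Lemma integral_pushforwardT d1 d2 (X : measurableType d1) (Y : measurableType d2)
    (h : X -> Y) (m : {measure set X -> \bar R}) (f : Y -> \bar R) :
  measurable_fun [set: X] h -> measurable_fun [set: Y] f ->
  \int[pushforward m h]_y f y = \int[m]_x f (h x).
Proof.
move=> mh mf; rewrite [LHS]integralE [RHS]integralE; congr (_ - _).
  rewrite ge0_integral_pushforward//; last exact: measurable_funepos.
  by apply: eq_integral => x _; rewrite /= !funeposE.
rewrite ge0_integral_pushforward//; last exact: measurable_funeneg.
by apply: eq_integral => x _; rewrite /= !funenegE.
Qed.

Definition law d d' (T : measurableType d) (T' : measurableType d')
    (P : probability T R) (Z : T -> T') (mZ : measurable_fun [set: T] Z) :
  probability T' R := distribution P (mfun_Sub (mem_set mZ)).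

Lemma lawE d d' (T : measurableType d) (T' : measurableType d')
    (P : probability T R) (Z : T -> T') (mZ : measurable_fun [set: T] Z) A :
  law P mZ A = P (Z @^-1` A).
Proof. by []. Qed.

Lemma integral_law d d' (T : measurableType d) (T' : measurableType d')
    (P : probability T R) (Z : T -> T') (mZ : measurable_fun [set: T] Z) (f : T' -> \bar R) :
  measurable_fun [set: T'] f -> \int[law P mZ]_y f y = \int[P]_x f (Z x).
Proof. by move=> mf; exact: (@integral_pushforwardT _ _ _ _ Z P f mZ mf). Qed.

Section GaussianLaw.
Context d (T : measurableType d) (P : probability T R) (n : nat).
Variables (Z : T -> 'cV[R]_n) (tau : T -> R).
Hypothesis ZN : std_normal_vec P Z.

Lemma rect_preimage (B : 'I_n -> set R) :
  Z @^-1` rect B = \bigcap_(i in setT) ((fun w => Z w i ord0) @^-1` B i).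
Proof. by apply/seteqP; split => w /= ZB i; [move=> _|]; exact: ZB. Qed.

Lemma std_normal_vec_measurable : measurable_fun [set: T] (Z : T -> W n).
Proof. by apply: measurable_cVP => i; have [+ _] := ZN; apply. Qed.

Lemma std_normal_vec_law : std_normal_law (law P std_normal_vec_measurable).
Proof.
move=> B mB; have [_ [N01 ind]] := ZN.
rewrite lawE rect_preimage ind//; apply: eq_bigr => i _; exact: N01.
Qed.

Hypothesis mtau : measurable_fun [set: T] tau.
Hypothesis ind : indep_scalar_vec P tau Z.

(** For fixed [A] both sides are finite measures in [B], equal on rectangles by hypothesis, hence
    equal on the generated sigma-algebra. *)
Lemma indep_prod (A : set R) (B : set (W n)) : measurable A -> measurable B ->
  P (tau @^-1` A `&` Z @^-1` B) = P (tau @^-1` A) * P (Z @^-1` B).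
Proof.
move=> mA mB; have mZ := std_normal_vec_measurable.
have mtA : measurable (tau @^-1` A) by rewrite -[X in measurable X]setTI; exact: mtau.
have fA : P (tau @^-1` A) \is a fin_num by exact: fin_num_measure.
have r0 : (0 <= fine (P (tau @^-1` A)))%R by rewrite fine_ge0.
pose m1 := pushforward (mrestr P mtA) (Z : T -> W n).
pose m2 := mscale (NngNum r0) (law P mZ).
have m1E C : m1 C = P (tau @^-1` A `&` Z @^-1` C) by rewrite setIC.
have m2E C : m2 C = P (tau @^-1` A) * P (Z @^-1` C) by rewrite /m2 /mscale/= fineK.
rewrite -m1E -m2E; apply: measure_cV_unique => // [C mC|].
  apply: (etrans (m1E _)); apply: etrans (esym (m2E _)).
  by rewrite rect_preimage; exact: ind.
apply: le_lt_trans (ltry 1%R).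
exact: (probability_le1 P (measurableI _ _ measurableT mtA)).
Qed.

Lemma integral_indep (g : R * W n -> \bar R) :
  measurable_fun [set: R * W n] g ->
  \int[P]_w g (tau w, Z w) =
  \int[P \x law P std_normal_vec_measurable]_x g (tau x.1, x.2).
Proof.
move=> mg; set mZ := std_normal_vec_measurable.
have mh1 : measurable_fun [set: T] (fun w => (tau w, Z w) : R * W n).
  exact: measurable_fun_pair.
have mh2 : measurable_fun [set: T * W n] (fun x => (tau x.1, x.2) : R * W n).
  apply: measurable_fun_pair; last exact: measurable_snd.
  exact: (measurableT_comp mtau measurable_fst).
rewrite -(integral_pushforwardT P mh1 mg) -(integral_pushforwardT _ mh2 mg).
apply: eq_measure_integral => A mA _.
(* Both pushforwards are the product of the laws of [tau] and [Z], as they have the right mass on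
   measurable rectangles. *)
transitivity ((law P mtau \x law P mZ) A).
  apply/esym/product_measure_unique => // B C mB mC.
  exact: indep_prod.
apply: product_measure_unique => // B C mB mC.
have mtB : measurable (tau @^-1` B) by rewrite -[X in measurable X]setTI; exact: mtau.
exact: (product_measure1E P (law P mZ) mtB mC).
Qed.

End GaussianLaw.
End Law.

(** * From normal errors to scale mixtures *)

Section Improvement.
Import numFieldNormedType.Exports.
Context {R : realType} {n p : nat} {X : 'M[R]_(n, p)}.
Hypothesis pn : (p.+1 < n)%N.
Hypothesis Xc : forall j : 'I_p, \sum_(i < n) X i j = 0.
Hypothesis rX : \rank X = p.
Local Notation W := (g_sigma_algebraType (@rects R n)).

Let n0 : (0 < n)%N. Proof. exact: leq_ltn_trans pn. Qed.

Lemma delta_U_ge0 y : 0 <= delta_U X y.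
Proof. by rewrite divr_ge0// RSS_ge0. Qed.

Lemma stein_loss_U a b s t z : 0 < s -> 0 < t ->
  stein_loss (delta_U X (obs X a b s (t *: z))) (s ^+ 2)
  = stein (t ^+ 2 * delta_U X z).
Proof.
move=> s0 t0; rewrite /stein_loss -/(stein _); congr stein.
rewrite /delta_U (RSS_obs n0 Xc rX).
have -> : RSS X (t *: z) = t ^+ 2 * RSS X z.
  by rewrite -(RSS_obs n0 Xc rX 0 0 t) /obs scale0r mulmx0 !add0r.
by field; rewrite pnatr_eq0 -lt0n subn_gt0 pn gt_eqF.
Qed.

(** The error scale is [s t] while the loss is normalized by [s^2]: a factor [t^2] survives in
    [RSS], and [R^2] sees the shift [(s t)^-1 X b]. *)
Lemma stein_loss_phi phi a b s t z : 0 < s -> 0 < t ->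
  stein_loss (delta_phi X phi (obs X a b s (t *: z))) (s ^+ 2)
  = stein (phi (Rsq X (z + (s * t)^-1 *: (X *m b))) * (t ^+ 2 * delta_U X z)).
Proof.
move=> s0 t0; rewrite /stein_loss -/(stein _); congr stein.
have -> : obs X a b s (t *: z) = obs X a b (s * t) z by rewrite /obs scalerA.
rewrite /delta_phi /delta_U (RSS_obs n0 Xc rX) (Rsq_obs n0 Xc rX); last first.
  by rewrite mulf_neq0// gt_eqF.
by field; rewrite pnatr_eq0 -lt0n subn_gt0 pn gt_eqF.
Qed.

Variable phi : R -> R.
Hypothesis phi_nd : {homo phi : x y / x <= y}.

Let phiRsq_itv x : phi 0 <= phi (Rsq X x) <= phi 1.
Proof. by have /andP[h1 h2] := Rsq_itv Xc rX x; rewrite !phi_nd. Qed.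

Hypothesis phi0 : 0 < phi 0.

Lemma measurable_delta_U : measurable_fun [set: W] (fun z : W => delta_U X z).
Proof. by apply: measurable_funM => //; exact: measurable_RSS. Qed.

Lemma measurable_phi_Rsq : measurable_fun [set: W] (fun z : W => phi (Rsq X z)).
Proof.
apply: (measurableT_comp (nondecreasing_measurable measurableT phi_nd)).
exact: measurable_Rsq.
Qed.

Lemma integral_delta_U_lty (mu : probability W R) : std_normal_law mu ->
  (\int[mu]_z (delta_U X z)%:E < +oo)%E.
Proof.
move=> muN; apply: le_lt_trans (integral_sqnorm_lty muN).
apply: ge0_le_integral => //.
- by move=> z _; rewrite lee_fin delta_U_ge0.
- by apply/measurable_EFinP; exact: measurable_delta_U.
- by apply/measurable_EFinP; exact: measurable_sqnorm.
move=> z _; rewrite lee_fin /delta_U ler_pdivrMr ?ltr0n ?subn_gt0//.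
apply: (le_trans (RSS_le_sqnorm _ n0 Xc rX)).
by rewrite ler_peMr ?sqnorm_ge0// ler1n subn_gt0.
Qed.

Lemma delta_U_line z b r : delta_U X (z + r *: (X *m b)) = delta_U X z.
Proof. by rewrite /delta_U (RSS_line n0 Xc rX). Qed.

(** As [delta_U] is constant along [X b], it may be shifted too. The integrand is then a shift of
    [phi(R^2) V], with envelope [phi 1 * V]. *)
Lemma integral_phi_delta_U_mono (mu : probability W R) b l1 l2 :
  std_normal_law mu -> 0 <= l1 <= l2 ->
  (\int[mu]_z (phi (Rsq X ((z : 'cV[R]_n) + l1 *: (X *m b))) * delta_U X z)%:E <=
   \int[mu]_z (phi (Rsq X ((z : 'cV[R]_n) + l2 *: (X *m b))) * delta_U X z)%:E)%E.
Proof.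
move=> muN l12; pose F (z : W) : R := phi (Rsq X z) * delta_U X z.
have FE l : (\int[mu]_z (phi (Rsq X ((z : 'cV[R]_n) + l *: (X *m b))) * delta_U X z)%:E =
             \int[mu]_z (F ((z : 'cV[R]_n) + l *: (X *m b))%R)%:E)%E.
  by apply: eq_integral => z _; rewrite /F delta_U_line.
rewrite !FE.
have phi_ge0 x : 0 <= phi (Rsq X x).
  by have /andP[h _] := phiRsq_itv x; exact: le_trans (ltW phi0) h.
have phi_le x : phi (Rsq X x) <= phi 1 by have /andP[] := phiRsq_itv x.
apply: (@le_integral_shift _ _ mu muN (X *m b) F (fun z => phi 1 * delta_U X z)) => //.
- apply: measurable_funM; [exact: measurable_phi_Rsq|exact: measurable_delta_U].
- by move=> z; rewrite mulr_ge0// delta_U_ge0.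
- by move=> z; rewrite /F /delta_U (RSS_N n0 Xc rX) (Rsq_N n0 Xc rX).
- move=> x r1 r2 bx r12; rewrite /F !delta_U_line ler_wpM2r ?delta_U_ge0//.
  by apply: phi_nd; exact: le_Rsq_line.
- by apply: measurable_funM => //; exact: measurable_delta_U.
- by move=> z; rewrite ler_wpM2r ?delta_U_ge0.
- by move=> x r; rewrite delta_U_line.
under eq_integral do rewrite EFinM.
rewrite ge0_integralZl//.
- by rewrite lte_mul_pinfty// ?lee_fin ?(le_trans (ltW phi0)) ?phi_nd// integral_delta_U_lty.
- by apply/measurable_EFinP; exact: measurable_delta_U.
- by move=> z _; rewrite lee_fin delta_U_ge0.
- by rewrite lee_fin (le_trans (ltW phi0))// phi_nd.
Qed.

Lemma improves_scale_mixture d (T : measurableType d) (P : probability T R)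
    (Z : T -> 'cV[R]_n) (tau : T -> R) :
  std_normal_vec P Z -> improves_on_U P X phi Z ->
  measurable_fun [set: T] tau -> (forall w, 0 < tau w) ->
  indep_scalar_vec P tau Z -> 'E_P[fun w => (tau w ^+ 2)%R]%E = 1%E ->
  improves_on_U P X phi (fun w => tau w *: Z w).
Proof.
move=> ZN imp mtau tau0 ind tau2 a b s s0.
have mZ := std_normal_vec_measurable ZN; have muN := std_normal_vec_law ZN.
set mu := law P _ in muN.
have mV := measurable_delta_U.
(* [`^ (-1)] is the inverse on the positive reals and is known to be measurable. *)
pose psi (t : R) (z : W) := phi (Rsq X ((z : 'cV[R]_n) + ((s * t) `^ (-1)) *: (X *m b))).
have psiE t z : 0 < t ->
    psi t z = phi (Rsq X ((z : 'cV[R]_n) + (s * t)^-1 *: (X *m b))).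
  by move=> t0; rewrite /psi powR_inv1// ltW// mulr_gt0.
have mpsi : measurable_fun [set: R * W] (fun tz => psi tz.1 tz.2).
  apply: (measurableT_comp measurable_phi_Rsq).
  apply: measurable_line; last exact: measurable_snd.
  apply: (measurableT_comp (measurable_powR _)).
  by apply: measurable_funM => //; exact: measurable_fst.
have mpsi2 t : measurable_fun [set: W] (psi t).
  exact: (measurable_fun_pair2 t mpsi).
have mpV t : measurable_fun [set: W] (fun z : W => psi t z * delta_U X z).
  exact: (measurable_funM (mpsi2 t) mV).
have mstein d' (T' : measurableType d') (f : T' -> R) : measurable_fun [set: T'] f ->
    measurable_fun [set: T'] (fun x => (stein (f x))%:E).
  move=> mf; apply: (measurable_EFinP _ _).2.
  exact: (measurableT_comp measurable_stein).
have mt2 : measurable_fun [set: R * W] (fun x => x.1 ^+ 2 * delta_U X x.2).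
  apply: measurable_funM; last exact: (measurableT_comp mV measurable_snd).
  by apply: measurable_funX; exact: measurable_fst.
have := @stein_mixture_le _ _ T W R P mu tau (delta_U X) psi (phi 0) (phi 1)
  mtau tau0 _ mV delta_U_ge0 (integral_delta_U_lty muN) mpsi phi0 (fun t z => phiRsq_itv _) _ _.
rewrite /risk unlock.
(* Independence moves both risks to the product space, where the mixture inequality applies. *)
have -> : (\int[P]_w (stein_loss (delta_phi X phi (obs X a b s (tau w *: Z w))) (s ^+ 2))%:E =
    \int[P \x mu]_x (stein (psi (tau x.1) x.2 * (tau x.1 ^+ 2 * delta_U X x.2)))%:E)%E.
  rewrite -(integral_indep ZN mtau ind
    (g := fun x => (stein (psi x.1 x.2 * (x.1 ^+ 2 * delta_U X x.2)))%:E)).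
    apply: eq_integral => w _.
    by rewrite (stein_loss_phi phi a b _ s0 (tau0 w)) /= (psiE _ _ (tau0 w)).
  by apply: mstein; exact: measurable_funM.
have -> : (\int[P]_w (stein_loss (delta_U X (obs X a b s (tau w *: Z w))) (s ^+ 2))%:E =
    \int[P \x mu]_x (stein (tau x.1 ^+ 2 * delta_U X x.2))%:E)%E.
  rewrite -(integral_indep ZN mtau ind
    (g := fun x => (stein (x.1 ^+ 2 * delta_U X x.2))%:E)).
    by apply: eq_integral => w _; rewrite stein_loss_U.
  exact: mstein.
apply.
- by move: tau2; rewrite unlock.
- move=> t t0; have st0 : 0 < s * t by rewrite mulr_gt0.
  (* Given [tau = t], the errors are normal with scale [s t], so improvement is invoked at that
     scale. *)
  have := imp a b (s * t) st0; rewrite /risk unlock.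
  have -> : (\int[P]_w (stein_loss (delta_phi X phi (obs X a b (s * t) (Z w))) ((s * t) ^+ 2))%:E =
      \int[mu]_z (stein (psi t z * delta_U X z))%:E)%E.
    rewrite [RHS]integral_law; last first.
      exact: (mstein _ W _ (mpV t)).
    apply: eq_integral => w _; rewrite -[in LHS](scale1r (Z w)) stein_loss_phi//.
    by rewrite expr1n mul1r mulr1 psiE.
  have -> : (\int[P]_w (stein_loss (delta_U X (obs X a b (s * t) (Z w))) ((s * t) ^+ 2))%:E =
      \int[mu]_z (stein (delta_U X z))%:E)%E.
    rewrite [RHS]integral_law; last exact: (mstein _ W _ mV).
    apply: eq_integral => w _; rewrite -[in LHS](scale1r (Z w)) stein_loss_U//.
    by rewrite expr1n mul1r.
  by [].
- move=> t1 t2 t10 t12; have t20 := lt_le_trans t10 t12.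
  have psif t : 0 < t -> psi t =
      fun z => phi (Rsq X ((z : 'cV[R]_n) + (s * t)^-1 *: (X *m b))).
    by move=> t0; apply/funext => z; exact: psiE.
  rewrite (psif t1 t10) (psif t2 t20).
  (* A larger [t] means the smaller shift [(s t)^-1], so monotonicity in the shift reverses. *)
  apply: integral_phi_delta_U_mono => //.
  apply/andP; split; first by rewrite invr_ge0 mulr_ge0// ltW.
  by rewrite lef_pV2 ?posrE ?mulr_gt0// ler_pM2l.
Qed.

End Improvement.

Unset Implicit Arguments.
Set Strict Implicit.

Theorem theorem3p1 (R : realType) (n p : nat) (X : 'M[R]_(n, p)) (phi : R -> R) :
  (p.+1 < n)%N ->
  (forall j : 'I_p, \sum_(i < n) X i j = 0) ->
  \rank X = p ->
  (forall x : R, 0 <= x <= 1 -> 0 < phi x) ->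
  (forall x y : R, 0 <= x <= 1 -> 0 <= y <= 1 -> x <= y -> phi x <= phi y) ->
  (* delta_phi improves on delta_U under normal errors *)
  (forall (d0 : measure_display) (T0 : measurableType d0)
          (P0 : probability T0 R) (Z0 : T0 -> 'cV[R]_n),
      std_normal_vec P0 Z0 -> improves_on_U P0 X phi Z0) ->
  (* then also under any scale mixture of normals eps = tau Z *)
  forall (d : measure_display) (T : measurableType d) (P : probability T R)
         (Z : T -> 'cV[R]_n) (tau : T -> R),
    std_normal_vec P Z ->
    measurable_fun setT tau ->
    (forall w, 0 < tau w) ->
    indep_scalar_vec P tau Z ->
    'E_P[fun w => (tau w ^+ 2)%R]%E = 1%E ->
    improves_on_U P X phi (fun w => tau w *: Z w).
Proof.
move=> pn Xc rX phi_gt0 phi_le normal d T P Z tau ZN mtau tau0 ind tau2.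
(* Clamping the argument to the unit interval makes [phi] monotone, hence measurable, on the whole
   line. The estimator is unchanged since [R^2] lies in that interval. *)
pose phic x := phi (Num.max 0 (Num.min x 1)).
have clamp_itv (x : R) : 0 <= Num.max 0 (Num.min x 1) <= 1.
  by rewrite le_max lexx ge_max ler01 ge_min lexx orbT.
have phic_nd : {homo phic : x y / x <= y}.
  move=> x y xy; apply: phi_le => //.
  by rewrite le_max2// le_min2.
have deltaE : delta_phi X phi = delta_phi X phic.
  apply/funext => y; rewrite /delta_phi /phic.
  by have /andP[R0 R1] := Rsq_itv Xc rX y; rewrite (min_l R1) (max_r R0).
have improvesE d' (T' : measurableType d') (P' : probability T' R) Z' :
    improves_on_U P' X phi Z' = improves_on_U P' X phic Z'.
  by rewrite /improves_on_U deltaE.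
rewrite improvesE; apply: improves_scale_mixture => //.
  by apply: phi_gt0.
by rewrite -improvesE; exact: normal.
Qed.
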